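(* Let $m,n\in\mathbb{N}$ be positive integers and let $T_m$ be an $m$-th Calderón-Zygmund type singular integral on $\mathbb{R}^n$. Let $x_0\in\mathbb{R}^n$ and let $1<p,p_i,q_i<\infty$ ($i=1,\dots,m$) be such that $1/p=1/p_1+1/p_2+\dots+1/p_m+1/q_1+1/q_2+\dots+1/q_m$. Let $b_i\in LC^{\{x_0\}}_{q_i,\lambda_i}$ with $0<\lambda_i<1/n$, $i=1,\dots,m$, and let $T_m^{\vec b}$ be the commutator generated by $T_m$ and $\vec b=(b_1,\dots,b_m)$. Then there is a constant $C>0$, independent of $r$, of $b_1,\dots,b_m$ and of $f_1,\dots,f_m$, such that the inequality $$\|T_m^{\vec b}(f_1,\dots,f_m)\|_{L^p(B(x_0,r))}\le C\prod_{i=1}^m\|b_i\|_{LC^{\{x_0\}}_{q_i,\lambda_i}}\; r^{n/p}\int_{2r}^\infty\left(1+\ln\frac tr\right)^m t^{\,n\sum_{i=1}^m\lambda_i-n\sum_{i=1}^m 1/p_i-1}\prod_{i=1}^m\|f_i\|_{L^{p_i}(B(x_0,t))}\,dt$$ holds for every $r>0$ and all $f_i\in L^{p_i}_{loc}(\mathbb{R}^n)$, $i=1,\dots,m$.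
   Context: $B(x_0,r)$ is the ball in $\mathbb{R}^n$ with center $x_0$ and radius $r$. **Local Campanato space.** For $1\le q<\infty$, $0\le\lambda<1/n$ and $x_0\in\mathbb{R}^n$, $LC^{\{x_0\}}_{q,\lambda}$ is the space of all $f\in L^q_{loc}(\mathbb{R}^n)$ with $$\|f\|_{LC^{\{x_0\}}_{q,\lambda}}=\sup_{r>0}\left(\frac{1}{|B(x_0,r)|^{1+\lambda q}}\int_{B(x_0,r)}|f(y)-f_{B(x_0,r)}|^q\,dy\right)^{1/q}<\infty,\qquad f_{B(x_0,r)}=\frac{1}{|B(x_0,r)|}\int_{B(x_0,r)}f(y)\,dy.$$ **$m$-th Calderón-Zygmund type singular integral.** Let $K(y_0,y_1,\dots,y_m)$ be a function defined away from the diagonal $y_0=y_1=\dots=y_m$ in $(\mathbb{R}^n)^{m+1}$ such that, for some $C>0$ and $\epsilon>0$, $$|K(y_0,y_1,\dots,y_m)|\le \frac{C}{\left(\sum_{k,l=0}^m|y_k-y_l|\right)^{mn}}$$ for all $(y_0,\dots,y_m)$ away from the diagonal, and $$|K(y_0,\dots,y_i,\dots,y_m)-K(y_0,\dots,y_i',\dots,y_m)|\le \frac{C|y_i-y_i'|^{\epsilon}}{\left(\sum_{k,l=0}^m|y_k-y_l|\right)^{mn+\epsilon}}$$ whenever $0\le i\le m$ and $|y_i-y_i'|\le \frac12\max_{0\le k\le m}|y_i-y_k|$. An $m$-th Calderón-Zygmund type singular integral is an $m$-linear operator $T_m$, initially defined on the $m$-fold product of the Schwartz space $\mathcal{S}(\mathbb{R}^n)$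 with values in the tempered distributions $\mathcal{S}'(\mathbb{R}^n)$, such that $$T_m(f_1,\dots,f_m)(x)=\int_{(\mathbb{R}^n)^m}K(x,y_1,\dots,y_m)f_1(y_1)\cdots f_m(y_m)\,dy_1\cdots dy_m$$ whenever $f_1,\dots,f_m$ are smooth with compact support and $x\notin\bigcap_{i=1}^m \mathrm{supp} f_i$. Standing fact about such operators: for all $1<s_1,\dots,s_m<\infty$ and $1/s=1/s_1+\dots+1/s_m$, $T_m$ extends to a bounded operator $L^{s_1}\times\dots\times L^{s_m}\to L^s$, i.e. $\|T_m(f_1,\dots,f_m)\|_{L^s}\le C\prod_i\|f_i\|_{L^{s_i}}$. **Commutator.** For locally integrable $b_1,\dots,b_m$, the commutator is (formally) $$T_m^{\vec b}(f_1,\dots,f_m)(x)=\int_{(\mathbb{R}^n)^m}K(x,y_1,\dots,y_m)\prod_{i=1}^m\big(b_i(x)-b_i(y_i)\big)f_i(y_i)\,dy_1\cdots dy_m.$$ It is understood as follows. For compactly supported $f_i\in L^{p_i}$, expand the product: $T_m^{\vec b}(f_1,\dots,f_m)(x)=\sum_{\sigma\subseteq\{1,\dots,m\}}(-1)^{|\sigma|}\prod_{i\notin\sigma}b_i(x)\,T_m(h_1^\sigma,\dots,h_m^\sigma)(x)$, where $h_i^\sigma=b_if_i$ if $i\in\sigma$ and $h_i^\sigma=f_i$ if $i\notin\sigma$, and $T_m$ is the bounded extension. For $f_i\in L^{p_i}_{loc}$, put $B=B(x_0,r)$, $2B=B(x_0,2r)$, $f_i^0=f_i\chi_{2B}$,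 $f_i^\infty=f_i\chi_{(2B)^c}$; on $B$, $T_m^{\vec b}(f_1,\dots,f_m)$ means $T_m^{\vec b}(f_1^0,\dots,f_m^0)$ plus the sum, over all other choices $(\alpha_1,\dots,\alpha_m)\in\{0,\infty\}^m$, of the integrals $\int K(x,y_1,\dots,y_m)\prod_i(b_i(x)-b_i(y_i))f_i^{\alpha_i}(y_i)\,dy_1\cdots dy_m$, which converge absolutely for a.e. $x\in B$ whenever the integral over $(2r,\infty)$ on the right-hand side of the claimed inequality is finite. If that integral is infinite, the inequality is regarded as trivially true. *)

(* Defs.v *)
From HB Require Import structures.
From mathcomp Require Import all_boot all_order all_algebra.
From mathcomp Require Import all_classical all_reals all_analysis.

Set Implicit Arguments.
Unset Strict Implicit.
Unset Printing Implicit Defensive.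

Import Order.TTheory GRing.Theory Num.Def Num.Theory.
Import numFieldNormedType.Exports.

Local Open Scope classical_set_scope.
Local Open Scope ring_scope.

Section sigma_finite_pushforward.
Context d1 d2 (T1 : measurableType d1) (T2 : measurableType d2) (R : realType).
Variables (mu : {measure set T1 -> \bar R}).
Variables (f : T1 -> T2) (g : T2 -> T1).
Hypotheses (muT : sigma_finite setT mu).
Hypotheses (mf : measurable_fun [set: T1] f) (fK : cancel f g)
  (mg : measurable_fun [set: T2] g).

Let nu : set T2 -> \bar R := pushforward mu f.

Let nu0 : nu set0 = 0%E. Proof. exact: measure0. Qed.

Let nu_ge0 A : (0 <= nu A)%E. Proof. exact: measure_ge0. Qed.

Let nu_semi_sigma_additive : semi_sigma_additive nu.
Proof. exact: measure_semi_sigma_additive. Qed.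

HB.instance Definition _ :=
  isMeasure.Build _ _ _ nu nu0 nu_ge0 nu_semi_sigma_additive.

Let nu_sigma_finite : sigma_finite setT nu.
Proof.
have [F FT mF] := muT.
exists (fun i => g @^-1` F i) => [|i].
  by rewrite -preimage_bigcup -FT preimage_setT.
have [mFi Fi_fin] := mF i; split.
  by rewrite -[X in measurable X]setTI; exact: mg.
rewrite /nu /pushforward -comp_preimage (_ : g \o f = id) //.
by apply/funext => x /=.
Qed.

HB.instance Definition _ := Measure_isSigmaFinite.Build _ _ _ nu nu_sigma_finite.

(* The left inverse [g] only serves to transport sigma-finiteness. *)
Definition sigma_finite_pushforward : {sigma_finite_measure set T2 -> \bar R} :=
  nu.

End sigma_finite_pushforward.

(* The library's own sigma-finite instance on [_ \x _] is shadowed by its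
   subprobability instance, hence this restatement. *)
Lemma sigma_finite_prod d1 d2 (T1 : measurableType d1)
    (T2 : measurableType d2) (R : realType)
    (m1 : {sigma_finite_measure set T1 -> \bar R})
    (m2 : {sigma_finite_measure set T2 -> \bar R}) :
  sigma_finite setT (m1 \x m2)%E.
Proof.
have /sigma_finiteP[F [TF ndF Foo]] := sigma_finiteT m1.
have /sigma_finiteP[G [TG ndG Goo]] := sigma_finiteT m2.
exists (fun n => F n `*` G n) => [|k].
  rewrite -setXTT TF TG predeqE => -[x y]; split => /=.
    move=> [/= [n _ Fnx] [k _ Gky]]; exists (maxn n k) => //; split.
    - by move: x Fnx; exact/subsetPset/ndF/leq_maxl.
    - by move: y Gky; exact/subsetPset/ndG/leq_maxr.
  by move=> [n _ []/= ? ?]; split; exists n.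
have [? ?] := Foo k; have [? ?] := Goo k.
split; first exact: measurableX.
by rewrite product_measure1E// lte_mul_pinfty// ge0_fin_numE.
Qed.

Section tuple_measure.
Context d (T : measurableType d) (R : realType).
Variable mu : {sigma_finite_measure set T -> \bar R}.

Let tcons n (xv : T * n.-tuple T) : n.+1.-tuple T := [tuple of xv.1 :: xv.2].
Let tuncons n (v : n.+1.-tuple T) : T * n.-tuple T :=
  (thead v, [tuple of behead v]).

Lemma measurable_tcons n : measurable_fun setT (@tcons n).
Proof. exact: measurable_cons. Qed.

Lemma measurable_tuncons n : measurable_fun setT (@tuncons n).
Proof.
apply/measurable_fun_pairP; split; first exact: measurable_tnth.
exact: measurable_behead.
Qed.

Lemma tconsK n : cancel (@tcons n) (@tuncons n).
Proof. by move=> [x v]; congr pair; apply/val_inj. Qed.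

Fixpoint tuple_measure n : {sigma_finite_measure set (n.-tuple T) -> \bar R} :=
  match n with
  | 0 => dirac [tuple]
  | k.+1 => sigma_finite_pushforward
      (sigma_finite_prod mu (tuple_measure k))
      (@measurable_tcons k) (@tconsK k) (@measurable_tuncons k)
  end.

End tuple_measure.

(* The sigma-algebra on R^n generated by the coordinates, that is, the Borel
   sigma-algebra. *)
Section rV_measurable.
Context (R : realType) (n : nat).

Let coor (i : 'I_n) (v : 'rV[R]_n) : R := v ord0 i.

Let rV_set0 : g_sigma_preimage coor set0.
Proof. exact: sigma_algebra0. Qed.

Let rV_setC A : g_sigma_preimage coor A -> g_sigma_preimage coor (~` A).
Proof. exact: sigma_algebraC. Qed.

Let rV_bigcup (F : _^nat) : (forall i, g_sigma_preimage coor (F i)) ->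
  g_sigma_preimage coor (\bigcup_i (F i)).
Proof. exact: sigma_algebra_bigcup. Qed.

HB.instance Definition _ := @isMeasurable.Build default_measure_display
  'rV[R]_n (g_sigma_preimage coor) rV_set0 rV_setC rV_bigcup.

End rV_measurable.

Section lebesgue_rV.
Context (R : realType) (n : nat).

Let to_row (t : n.-tuple R) : 'rV[R]_n := \row_i tnth t i.
Let of_row (v : 'rV[R]_n) : n.-tuple R := [tuple v ord0 i | i < n].

Lemma measurable_coor (i : 'I_n) :
  measurable_fun setT (fun v : 'rV[R]_n => v ord0 i).
Proof.
move=> _ Y mY; rewrite setTI; apply: sub_sigma_algebra => /=.
rewrite -bigcup_seq/=; exists i => /=; first by rewrite mem_index_enum.
by exists Y => //; rewrite setTI.
Qed.

Lemma measurable_of_row : measurable_fun setT of_row.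
Proof.
apply/measurable_fun_tnthP => i.
rewrite (_ : _ \o _ = fun v : 'rV[R]_n => v ord0 i); first exact: measurable_coor.
by apply/funext => v /=; rewrite tnth_mktuple.
Qed.

Lemma measurable_to_row : measurable_fun setT to_row.
Proof.
move=> _ Y mY.
suff : preimage_set_system setT to_row measurable `<=` measurable.
  by apply; exists Y.
rewrite -(g_sigma_preimage_comp (fun i (v : 'rV[R]_n) => v ord0 i : R)).
rewrite (_ : (fun i => _ \o to_row) = fun i t => tnth t i)//.
by apply/funext => i; apply/funext => t /=; rewrite mxE.
Qed.

Lemma to_rowK : cancel to_row of_row.
Proof. by move=> t; apply/eq_from_tnth => i; rewrite tnth_mktuple mxE. Qed.

Definition lebesgue_rV : {sigma_finite_measure set 'rV[R]_n -> \bar R} :=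
  sigma_finite_pushforward (sigma_finiteT (tuple_measure lebesgue_measure n))
    measurable_to_row to_rowK measurable_of_row.

End lebesgue_rV.

Arguments lebesgue_rV {R n}.

Section euclidean.
Context (R : realType) (n : nat).
Implicit Types x : 'rV[R]_n.

(* The norm provided by the library on ['rV[R]_n] is the sup norm. *)
Definition euclidean_norm x : R := Num.sqrt (\sum_(i < n) x ord0 i ^+ 2).

Definition euclidean_ball x0 (r : R) : set 'rV[R]_n := [set x | euclidean_norm (x - x0) < r].

End euclidean.

Section schwartz.
Context (R : realType) (n : nat).
Implicit Types (f phi : 'rV[R]_n -> R) (s t : seq 'I_n).

(* Multi-indices are represented by sequences of coordinates:
   [:: i1; ...; ik] stands for x_i1 ... x_ik and for d_i1 ... d_ik. *)
Definition monomial t (x : 'rV[R]_n) : R := \prod_(i <- t) x ord0 i.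

Definition pderiv s f : 'rV[R]_n -> R :=
  foldr (fun i (g : 'rV[R]_n -> R) => fun x => 'D_(delta_mx 0 i) g x) f s.

Definition smooth f := forall s, continuous (pderiv s f) /\
  forall i x, derivable (pderiv s f) x (delta_mx 0 i).

Definition schwartz_seminorm t s f : \bar R :=
  ereal_sup (range (fun x => `|monomial t x * pderiv s f x|%:E)).

Definition schwartz : set ('rV[R]_n -> R) := [set f | smooth f /\
  forall t s, (schwartz_seminorm t s f < +oo)%E].

Definition tempered_distribution : set (('rV[R]_n -> R) -> R) := [set u |
  (forall (a : R) phi psi, schwartz phi -> schwartz psi ->
    u (a \*o phi \+ psi) = a * u phi + u psi) /\
  exists (C : R) (F : seq (seq 'I_n * seq 'I_n)), forall phi, schwartz phi ->
    (`|u phi|%:E <= C%:E * \sum_(ts <- F) schwartz_seminorm ts.1 ts.2 phi)%E].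

Definition tsupp f : set 'rV[R]_n := closure [set x | f x != 0].

Definition test_function : set ('rV[R]_n -> R) :=
  [set f | smooth f /\ compact (tsupp f)].

End schwartz.

Section function_spaces.
Context (R : realType) (n : nat).
Implicit Types (f : 'rV[R]_n -> R) (B : set 'rV[R]_n).

Definition Lnorm_on (p : R) B f : \bar R :=
  ('N[lebesgue_rV]_p%:E [EFin \o (f \_ B)])%E.

Definition Lloc (p : R) : set ('rV[R]_n -> R) := [set f |
  measurable_fun setT f /\ forall A, compact A -> (Lnorm_on p A f < +oo)%E].

Definition average B f : R :=
  (fine (lebesgue_rV B))^-1 * \int[lebesgue_rV]_(y in B) f y.

Definition campanato_norm (x0 : 'rV[R]_n) (q lambda : R) f : \bar R :=
  ereal_sup [set
    ((fine (lebesgue_rV (euclidean_ball x0 r)) `^ (1 + lambda * q))^-1%:E *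
     \int[lebesgue_rV]_(y in euclidean_ball x0 r)
       (`|f y - average (euclidean_ball x0 r) f| `^ q)%:E) `^ q^-1
    | r in [set r : R | 0 < r]%R]%E.

Definition campanato (x0 : 'rV[R]_n) (q lambda : R) : set ('rV[R]_n -> R) :=
  [set f | Lloc q f /\ (campanato_norm x0 q lambda f < +oo)%E].

End function_spaces.

Section calderon_zygmund.
Context (R : realType) (m n : nat).
Local Notation Rn := 'rV[R]_n.
Implicit Types (f b : 'I_m -> Rn -> R) (K : m.+1.-tuple Rn -> R)
  (T : ('I_m -> Rn -> R) -> Rn -> R).

Definition replace_tnth k (y : k.-tuple Rn) (i : 'I_k) (z : Rn) : k.-tuple Rn :=
  [tuple if j == i then z else tnth y j | j < k].

Definition replace_fun f (i : 'I_m) (g : Rn -> R) : 'I_m -> Rn -> R :=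
  fun j => if j == i then g else f j.

Definition off_diagonal (y : m.+1.-tuple Rn) :=
  exists k l, tnth y k != tnth y l.

Definition dist_sum (y : m.+1.-tuple Rn) : R :=
  \sum_(k < m.+1) \sum_(l < m.+1) euclidean_norm (tnth y k - tnth y l).

(* Only the values of [K] off the diagonal are constrained. *)
Definition cz_kernel K := exists C eps : R, [/\ 0 < C, 0 < eps,
  forall y, off_diagonal y -> `|K y| <= C / dist_sum y ^+ (m * n) &
  forall y i z, off_diagonal y ->
    euclidean_norm (tnth y i - z) <=
      2^-1 * \big[Num.max/0]_(k < m.+1) euclidean_norm (tnth y i - tnth y k) ->
    `|K y - K (replace_tnth y i z)| <=
      C * euclidean_norm (tnth y i - z) `^ eps / dist_sum y `^ ((m * n)%:R + eps)].

Definition cz_integral K f (x : Rn) : R :=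
  \int[tuple_measure lebesgue_rV m]_y
    (K [tuple of x :: y] * \prod_(i < m) f i (tnth y i)).

(* [S f phi] is the value of the distribution S(f_1, ..., f_m) at phi.  The
   integral representation is the equality of distributions, on the complement
   of the intersection of the supports, of S(f_1, ..., f_m) with the function
   given by the integral. *)
Definition cz_operator K (S : ('I_m -> Rn -> R) -> (Rn -> R) -> R) :=
  [/\ forall f, (forall i, schwartz (f i)) -> tempered_distribution (S f),
    forall f i (a : R) g h phi, (forall j, schwartz (f j)) ->
      schwartz g -> schwartz h -> schwartz phi ->
      S (replace_fun f i (a \*o g \+ h)) phi =
      a * S (replace_fun f i g) phi + S (replace_fun f i h) phi &
    forall f phi, (forall i, test_function (f i)) -> test_function phi ->
      tsupp phi `&` \bigcap_i tsupp (f i) = set0 ->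
      S f phi = \int[lebesgue_rV]_x (cz_integral K f x * phi x)].

(* [T] is the extension of [S] to the products L^{s_1} x ... x L^{s_m} for all
   exponents s_i in (1, +oo); the target exponent s may be smaller than 1. *)
Definition bounded_extension (S : ('I_m -> Rn -> R) -> (Rn -> R) -> R)
    (T : ('I_m -> Rn -> R) -> Rn -> R) :=
  (forall f phi, (forall i, schwartz (f i)) -> schwartz phi ->
    S f phi = \int[lebesgue_rV]_x (T f x * phi x)) /\
  forall (s_ : 'I_m -> R) (s : R), (forall i, 1 < s_ i) ->
    s^-1 = \sum_(i < m) (s_ i)^-1 ->
  [/\ forall f, (forall i, f i \in Lfun lebesgue_rV (s_ i)%:E) ->
        measurable_fun setT (T f),
    forall f i (a : R) g h, (forall j, f j \in Lfun lebesgue_rV (s_ j)%:E) ->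
      g \in Lfun lebesgue_rV (s_ i)%:E -> h \in Lfun lebesgue_rV (s_ i)%:E ->
      {ae lebesgue_rV, forall x, T (replace_fun f i (a \*o g \+ h)) x =
        a * T (replace_fun f i g) x + T (replace_fun f i h) x} &
    exists2 C : R, 0 < C & forall f,
      (forall i, f i \in Lfun lebesgue_rV (s_ i)%:E) ->
      ('N[lebesgue_rV]_s%:E [EFin \o T f] <=
        C%:E * \prod_(i < m) 'N[lebesgue_rV]_(s_ i)%:E [EFin \o f i])%E].

(* The commutator of compactly supported functions, by expansion of the product
   of the b_i(x) - b_i(y_i). *)
Definition cz_commutator_cs T b f (x : Rn) : R :=
  \sum_(sigma : {set 'I_m}) (-1) ^+ #|sigma| *
    (\prod_(i in ~: sigma) b i x) *
    T (fun i => if i \in sigma then b i \* f i else f i) x.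

Definition cz_commutator_integrand K b f (x : Rn) (y : m.-tuple Rn) : R :=
  K [tuple of x :: y] *
  \prod_(i < m) ((b i x - b i (tnth y i)) * f i (tnth y i)).

(* The functions f_i^{alpha_i}, with alpha the set of the i such that
   alpha_i = oo. *)
Definition split_fun (x0 : Rn) (r : R) (alpha : {set 'I_m}) f : 'I_m -> Rn -> R :=
  fun i => if i \in alpha then f i \_ (~` euclidean_ball x0 (2 * r))
           else f i \_ (euclidean_ball x0 (2 * r)).

(* Only meaningful for x in the ball B(x0, r). *)
Definition cz_commutator K T x0 r b f (x : Rn) : R :=
  cz_commutator_cs T b (split_fun x0 r finset.set0 f) x +
  \sum_(alpha : {set 'I_m} | alpha != finset.set0)
    \int[tuple_measure lebesgue_rV m]_y
      cz_commutator_integrand K b (split_fun x0 r alpha f) x y.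

End calderon_zygmund.

(* Main.v *)
Require Import Defs.
From mathcomp Require Import all_boot all_order all_algebra.
From mathcomp Require Import all_classical all_reals all_analysis.
From mathcomp Require Import measurable_realfun lra ring.

Import Order.TTheory GRing.Theory Num.Def Num.Theory.
Import numFieldNormedType.Exports.

Local Open Scope classical_set_scope.
Local Open Scope ring_scope.

Set Implicit Arguments.
Unset Strict Implicit.
Unset Printing Implicit Defensive.

(* Let x be in B = B(x0,r).  As soon as one y_i lies outside 2B, the number
   t0 = max_j |y_j - x0| is at least 2r and |K(x,y)| <= C t0^(-mn), and t0^(-mn) is
   at most a constant times the integral of t^(-mn-1) over ]t0, +oo[.  By Tonelli all
   the mixed integrals are bounded, simultaneously, by the integral over ]2r, +oo[ of
     t^(-mn-1) prod_i int_{B(x0,t)} |b_i(x) - b_i(y)| |f_i(y)| dy,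
   and Hoelder's inequality together with the Campanato bound
     ||b_i - b_{i,B}||_{L^q(B(x0,t))} <= A t^(n/q + n lambda) ||b_i||   (t >= r)
   bounds the i-th factor by t^(n - n/p_i + n lambda_i) ||f_i||_{L^{p_i}(B(x0,t))} G_i(x),
   where G_i(x) = r^(-n lambda_i) |b_i(x) - b_{i,B}| + ||b_i|| does not depend on t.
   It remains to apply Hoelder's inequality to prod_i G_i on B.  In the local part, the
   expansion of the commutator does not change when b_i is replaced by b_i - b_{i,B},
   and each of its terms is bounded by Hoelder's inequality and the boundedness of T. *)

(** * Powers, products, integrals and Hoelder inequalities *)

(** Writing t0^(-mn) as an integral over t pays off because max_j |y_j - x0| < t describes a product
    of balls: for fixed t the variables y_1, ..., y_m separate, and it no longer matters which of
    the f_i carry the part outside 2B. Measurability shapes the proof. The kernel is not assumed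
    measurable, so this is derived from its regularity. Measurability in x of the commutator is
    never established: T is linear only almost everywhere and the mixed integrals are merely
    dominated. Norms are therefore compared with those of measurable majorants, by monotonicity
    results that assume nothing about the smaller function. In the local part T is used with two
    kinds of exponents. Replacing b_i by b_i - b_{i,B} needs one tuple of exponents valid for all
    terms of the expansion, which the truncation to 2B makes possible; the estimate of a term needs
    a tuple depending on that term. *)

Lemma powRD_gt0 (R : realType) (x r s : R) : 0 < x -> x `^ (r + s) = x `^ r * x `^ s.
Proof. by move=> x0; rewrite powRD// (gt_eqF x0) implybT. Qed.

Lemma powR_prod (R : realType) (I : Type) (l : seq I) (P : pred I) (x : R) (a : I -> R) :
  0 < x -> \prod_(i <- l | P i) x `^ a i = x `^ (\sum_(i <- l | P i) a i).
Proof.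
move=> x0; elim: l => [|i l IH]; first by rewrite !big_nil powRr0.
by rewrite !big_cons; case: ifPn => // _; rewrite powRD_gt0// IH.
Qed.

Lemma lee_prod (R : realDomainType) (I : Type) (l : seq I) (P : pred I) (f g : I -> \bar R) :
  (forall i, P i -> (0 <= f i <= g i)%E) ->
  (\prod_(i <- l | P i) f i <= \prod_(i <- l | P i) g i)%E.
Proof.
move=> fg; elim: l => [|i l IH]; first by rewrite !big_nil.
rewrite !big_cons; case: ifPn => // Pi; have /andP[f0 fgi] := fg i Pi.
by apply: lee_pmul => //; apply: prode_ge0 => j /fg /andP[].
Qed.

Section measure_prelim.
Context d (X : measurableType d) (R : realType) (mu : {measure set X -> \bar R}).
Local Open Scope ereal_scope.

(** The integral of a nonnegative function is a supremum over the simple functions below it, so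
    monotonicity holds without measurability. *)
Lemma ge0_le_integral_nomeas (D : set X) (f g : X -> \bar R) :
  (forall x, D x -> 0 <= f x) -> (forall x, D x -> f x <= g x) ->
  \int[mu]_(x in D) f x <= \int[mu]_(x in D) g x.
Proof.
move=> f0 fg; have g0 x : D x -> 0 <= g x by move=> Dx; rewrite (le_trans (f0 _ Dx))// fg.
rewrite !ge0_integralE//; apply: ereal_sup_le => _ [h hf <-].
exists h => // x; apply: le_trans (hf x) _; rewrite !patchE.
by case: ifPn => // /set_mem; exact: fg.
Qed.

(** Raising [g] to [+oo] on the exceptional null set does not change its integral and makes the
    inequality hold everywhere. Only the majorant has to be measurable. *)
Lemma ae_ge0_le_integral_nomeas (f g : X -> \bar R) :
  (forall x, 0 <= f x) -> (forall x, 0 <= g x) -> measurable_fun setT g ->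
  {ae mu, forall x, f x <= g x} ->
  \int[mu]_x f x <= \int[mu]_x g x.
Proof.
move=> f0 g0 mg [N [mN muN sN]].
have mh : measurable_fun setT (fun x => if x \in N then +oo else g x).
  apply: measurable_fun_ifT => //.
  by apply: (measurable_fun_bool true); rewrite setTI preimage_mem_true.
rewrite (_ : \int[mu]_x g x = \int[mu]_x (if x \in N then +oo else g x)).
  apply: ge0_le_integral_nomeas => // x _.
  case: ifPn => [|xN]; first by rewrite leey.
  apply: contrapT => fgx; move: xN; rewrite notin_setE; apply; exact: sN.
apply: ge0_ae_eq_integral => //.
- by move=> x _; case: ifPn => // _; rewrite leey.
- exists N; split => // x /=; apply: contra_notP => xN _.
  by rewrite memNset.
Qed.

Lemma le_Lnorm_nomeas (p : R) (f g : X -> R) : (0 <= p)%R ->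
  (forall x, (`|f x| <= `|g x|)%R) ->
  'N[mu]_p%:E[EFin \o f] <= 'N[mu]_p%:E[EFin \o g].
Proof.
move=> p0 fg; rewrite unlock /=.
apply: gt0_ler_poweR; rewrite ?invr_ge0//.
- by rewrite in_itv/= leey integral_ge0.
- by rewrite in_itv/= leey integral_ge0.
- apply: ge0_le_integral_nomeas => // x _; rewrite lee_fin.
  by apply: ge0_ler_powR; rewrite ?nnegrE.
Qed.

Lemma ae_le_Lnorm_nomeas (p : R) (f g : X -> R) : (0 <= p)%R ->
  measurable_fun setT g ->
  {ae mu, forall x, (`|f x| <= `|g x|)%R} ->
  'N[mu]_p%:E[EFin \o f] <= 'N[mu]_p%:E[EFin \o g].
Proof.
move=> p0 mg fg; rewrite unlock /=.
apply: gt0_ler_poweR; rewrite ?invr_ge0//.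
- by rewrite in_itv/= leey integral_ge0.
- by rewrite in_itv/= leey integral_ge0.
- apply: ae_ge0_le_integral_nomeas => //.
    apply: measurableT_comp => //; apply: (measurableT_comp (measurable_powR _)).
    exact: measurableT_comp.
  apply: filterS fg => x fg; rewrite lee_fin.
  by apply: ge0_ler_powR; rewrite ?nnegrE.
Qed.

Lemma Lnorm_powR (a r : R) (f : X -> R) : (0 < a)%R -> (0 < r)%R ->
  'N[mu]_(r / a)%:E[EFin \o (fun x => `|f x| `^ a)%R] = 'N[mu]_r%:E[EFin \o f] `^ a.
Proof.
move=> a0 r0; rewrite unlock /= -poweRrM; congr (_ `^ _); last first.
  by rewrite invf_div mulrC.
apply: eq_integral => x _ /=; rewrite ger0_norm ?powR_ge0//.
by rewrite -powRrM mulrCA divff ?mulr1// gt_eqF.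
Qed.

(** The classical inequality for [|f|^p] and [|g|^p] with the conjugate exponents [r / p] and
    [s / p], followed by a p-th root. *)
Lemma generalized_hoelder (p r s : R) (f g : X -> R) :
  measurable_fun setT f -> measurable_fun setT g ->
  (0 < p)%R -> (0 < r)%R -> (0 < s)%R -> (p^-1 = r^-1 + s^-1)%R ->
  'N[mu]_p%:E[EFin \o (f \* g)%R] <= 'N[mu]_r%:E[EFin \o f] * 'N[mu]_s%:E[EFin \o g].
Proof.
move=> mf mg p0 r0 s0 pE.
have mpow (h : X -> R) : measurable_fun setT h ->
    measurable_fun setT (fun x => `|h x| `^ p)%R.
  move=> mh; apply: (measurableT_comp (measurable_powR _)).
  exact: measurableT_comp.
have := @hoelder _ _ _ mu _ _ (r / p) (s / p) (mpow _ mf) (mpow _ mg)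
  (divr_gt0 r0 p0) (divr_gt0 s0 p0).
rewrite !invf_div -[(p / r + p / s)%R]mulrDr -pE mulfV ?gt_eqF// => /(_ erefl).
rewrite !Lnorm_powR// => H.
rewrite -(@poweRe1 _ 'N[mu]_p%:E[_]) ?Lnorm_ge0//.
rewrite -(@poweRe1 _ (_ * _)) ?mule_ge0 ?Lnorm_ge0//.
rewrite -(@mulfV _ p) ?gt_eqF// !poweRrM.
apply: gt0_ler_poweR.
- by rewrite invr_ge0 ltW.
- by rewrite in_itv/= leey poweR_ge0.
- by rewrite in_itv/= leey poweR_ge0.
rewrite poweRM ?Lnorm_ge0//. apply: le_trans H.
rewrite -Lnorm_powR// divff ?gt_eqF//.
rewrite le_eqVlt; apply/orP; left; apply/eqP; congr Lnorm.
by apply/funext => x /=; rewrite normrM powRM.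
Qed.

(** The distinguished factor [f] is the accumulator of the induction: it absorbs the [g i] one at a
    time while the inverse of its exponent grows by [(q i)^-1]. It is later the indicator of a ball
    or a value of the operator [T]. *)
Lemma generalized_hoelder_prod (I : Type) (l : seq I) (P : pred I) (q : I -> R)
    (p r : R) (f : X -> R) (g : I -> X -> R) :
  measurable_fun setT f -> (forall i, measurable_fun setT (g i)) ->
  (0 < p)%R -> (0 < r)%R -> (forall i, 0 < q i)%R ->
  (p^-1 = r^-1 + \sum_(i <- l | P i) (q i)^-1)%R ->
  'N[mu]_p%:E[EFin \o (fun x => f x * \prod_(i <- l | P i) g i x)%R] <=
  'N[mu]_r%:E[EFin \o f] * \prod_(i <- l | P i) 'N[mu]_(q i)%:E[EFin \o g i].
Proof.
move=> mf mg p0 r0 q0; elim: l f r r0 mf => [|i l IH] f r r0 mf.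
  rewrite !big_nil addr0 mule1 => /invr_inj ->.
  by rewrite le_eqVlt; apply/orP; left; apply/eqP; congr Lnorm; apply/funext => x /=;
    rewrite big_nil mulr1.
rewrite !big_cons; case: ifPn => Pi pE; last first.
  under eq_fun do rewrite big_cons (negbTE Pi).
  exact: IH.
have ri0 : (0 < r^-1 + (q i)^-1)%R by rewrite addr_gt0// invr_gt0.
have := IH (f \* g i)%R (r^-1 + (q i)^-1)^-1%R.
rewrite invrK -addrA invr_gt0 => /(_ ri0 (measurable_funM mf (mg i)) pE) H.
apply: (@le_trans _ _ ('N[mu]_((r^-1 + (q i)^-1)^-1%R)%:E[EFin \o (f \* g i)%R] *
   \prod_(i <- l | P i) 'N[mu]_(q i)%:E[EFin \o g i])).
  apply: le_trans H.
  rewrite le_eqVlt; apply/orP; left; apply/eqP; congr Lnorm; apply/funext => x /=.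
  by rewrite big_cons Pi mulrA.
rewrite muleA; apply: lee_wpmul2r.
  by apply: prode_ge0 => j _; exact: Lnorm_ge0.
by apply: generalized_hoelder => //; rewrite ?invr_gt0 ?invrK.
Qed.

Lemma Lnorm_sum (p : R) (I : Type) (l : seq I) (f : I -> X -> R) : (1 <= p)%R ->
  (forall i, measurable_fun setT (f i)) ->
  'N[mu]_p%:E[EFin \o (fun x => \sum_(i <- l) f i x)%R] <=
  \sum_(i <- l) 'N[mu]_p%:E[EFin \o f i].
Proof.
move=> p1 mf; elim: l => [|i l IH].
  rewrite big_nil (_ : _ \o _ = cst 0) ?Lnorm0//.
    by rewrite eqe gt_eqF// (lt_le_trans _ p1).
  by apply/funext => x /=; rewrite big_nil.
rewrite big_cons (_ : _ \o _ = EFin \o (f i \+ (fun x => \sum_(i <- l) f i x))%R).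
  apply: le_trans (minkowski_EFin _ _ _ p1) _ => //; first exact: measurable_sum.
  by rewrite leeD2l.
by apply/funext => x /=; rewrite big_cons.
Qed.

Lemma LnormZ_EFin (p a : R) (f : X -> R) : (0 < p)%R -> (0 <= a)%R ->
  measurable_fun setT f ->
  'N[mu]_p%:E[EFin \o (fun x => a * f x)%R] = a%:E * 'N[mu]_p%:E[EFin \o f].
Proof.
move=> p0 a0 mf; rewrite unlock /=.
under eq_integral do rewrite normrM (ger0_norm a0) powRM// EFinM.
rewrite ge0_integralZl_EFin ?powR_ge0//; first last.
- apply: measurableT_comp => //; apply: (measurableT_comp (measurable_powR _)).
  exact: measurableT_comp.
rewrite poweRM ?lee_fin ?powR_ge0//; first last.
  by apply: integral_ge0 => x _; rewrite lee_fin powR_ge0.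
by rewrite -poweR_EFin -poweRrM divff ?gt_eqF// poweRe1.
Qed.

End measure_prelim.

(** * Lebesgue measure on tuples and on row vectors *)

Lemma emeasurable_prod d (X : measurableType d) (R : realType) (I : Type)
    (l : seq I) (P : pred I) (f : I -> X -> \bar R) :
  (forall i, measurable_fun setT (f i)) ->
  measurable_fun setT (fun x => \prod_(i <- l | P i) f i x)%E.
Proof.
move=> mf; elim: l => [|i l IH].
  by under eq_fun do rewrite big_nil; exact: measurable_cst.
under eq_fun do rewrite big_cons.
by case: (P i) => //; exact: emeasurable_funM.
Qed.

Section tuple_measure_theory.
Context d (X : measurableType d) (R : realType).
Variable mu : {sigma_finite_measure set X -> \bar R}.
Local Open Scope ereal_scope.

Lemma ge0_integral_tuple_measureS k (f : k.+1.-tuple X -> \bar R) :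
  measurable_fun setT f -> (forall v, 0 <= f v) ->
  \int[tuple_measure mu k.+1]_v f v =
  \int[mu]_x \int[tuple_measure mu k]_w f [tuple of x :: w].
Proof.
move=> mf f0.
transitivity (\int[pushforward (mu \x tuple_measure mu k)
    (fun xv : X * k.-tuple X => [tuple of xv.1 :: xv.2])]_v f v).
  by [].
rewrite ge0_integral_pushforward//; last exact: measurable_tcons.
rewrite preimage_setT fubini_tonelli1//; last by move=> x /=; exact: f0.
by apply: measurableT_comp => //; exact: measurable_tcons.
Qed.

Lemma ge0_integral_tuple_prod k (g : 'I_k -> X -> \bar R) :
  (forall i, measurable_fun setT (g i)) -> (forall i x, 0 <= g i x) ->
  \int[tuple_measure mu k]_v (\prod_(i < k) g i (tnth v i)) =
  \prod_(i < k) \int[mu]_x g i x.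
Proof.
elim: k g => [|k IH] g mg g0.
  rewrite big_ord0 (_ : (fun v => _) = cst 1); last first.
    by apply/funext => v; rewrite big_ord0.
  transitivity (\int[\d_ [tuple]]_(v in [set: 0.-tuple X]) (cst 1 : _ -> \bar R) v) => //.
  by rewrite integral_dirac//= mule1 diracT.
have mprod j (h : 'I_j -> X -> \bar R) : (forall i, measurable_fun setT (h i)) ->
    measurable_fun setT (fun v : j.-tuple X => \prod_(i < j) h i (tnth v i)).
  move=> mh; apply: emeasurable_prod => i.
  exact: (measurableT_comp (mh i) (measurable_tnth i)).
rewrite ge0_integral_tuple_measureS//; first last.
- by move=> v; apply: prode_ge0.
- exact: mprod.
rewrite big_ord_recl -IH//.
rewrite -ge0_integralZr//; last by apply: integral_ge0 => v _; exact: prode_ge0.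
apply: eq_integral => x _.
rewrite -ge0_integralZl//; first last.
- by move=> v _; exact: prode_ge0.
- exact: (mprod _ (fun i => g (lift ord0 i))).
apply: eq_integral => v _.
rewrite big_ord_recl tnth0; congr (_ * _).
by apply: eq_bigr => i _; rewrite tnthS.
Qed.

End tuple_measure_theory.

Section lebesgue_rV_theory.
Context (R : realType) (n : nat).
Local Notation Rn := 'rV[R]_n.
Local Open Scope ereal_scope.

Lemma ge0_integral_lebesgue_rV (f : Rn -> \bar R) :
  measurable_fun setT f -> (forall x, 0 <= f x) ->
  \int[lebesgue_rV]_x f x =
  \int[tuple_measure lebesgue_measure n]_t f (\row_i tnth t i)%R.
Proof.
move=> mf f0.
transitivity (\int[pushforward (tuple_measure lebesgue_measure n)
    (fun t : n.-tuple R => (\row_i tnth t i)%R : Rn)]_x f x); first by [].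
by rewrite ge0_integral_pushforward//; exact: measurable_to_row.
Qed.

(** Balls of the sup norm, whose measure is a product of lengths of intervals. A Euclidean ball lies
    between two of them with radii in a fixed ratio, and these two bounds stand in for its exact
    volume throughout. *)
Definition cube (x0 : Rn) (r : R) : set Rn :=
  [set x | forall i, (`|x ord0 i - x0 ord0 i| < r)%R].

Let mcoorB (x0 : Rn) i :
  measurable_fun setT (fun x : Rn => x ord0 i - x0 ord0 i)%R.
Proof. by apply: measurable_funB => //; exact: measurable_coor. Qed.

Lemma measurable_cube x0 r : measurable (cube x0 r).
Proof.
rewrite (_ : cube x0 r =
    \bigcap_(i in [set: 'I_n]) [set x : Rn | (`|x ord0 i - x0 ord0 i| < r)%R]).
  apply: fin_bigcap_measurable => // i _; rewrite -[X in measurable X]setTI.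
  apply: (@measurable_fun_ltr _ _ _ _ (fun x : Rn => `|x ord0 i - x0 ord0 i|)%R (cst r)) => //.
  exact: measurableT_comp.
by apply/seteqP; split => [x xc i _|x xc i]; exact: xc.
Qed.

Lemma lebesgue_rV_cube x0 r : (0 <= r)%R ->
  lebesgue_rV (cube x0 r) = ((2 * r) ^+ n)%:E.
Proof.
move=> r0; transitivity (\int[lebesgue_rV]_x (\1_(cube x0 r) x)%:E).
  by rewrite integral_indic ?setIT//; exact: measurable_cube.
rewrite ge0_integral_lebesgue_rV; first last.
- by move=> x; rewrite lee_fin indicE.
- by apply/measurable_EFinP; apply: measurable_indic; exact: measurable_cube.
transitivity (\int[tuple_measure lebesgue_measure n]_t
   \prod_(i < n) (\1_(ball (x0 ord0 i) r) (tnth t i))%:E : \bar R).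
  apply: eq_integral => t _; rewrite prodEFin; congr EFin.
  rewrite indicE; case: (boolP (_ \in _)) => [|/negP].
    rewrite inE => tc; rewrite big1// => i _; rewrite indicE mem_set//.
    by have := tc i; rewrite mxE /ball /= distrC.
  rewrite inE => tc; apply/esym/eqP/prodf_eq0.
  have /existsNP[i ti] : ~ forall i, (`|tnth t i - x0 ord0 i| < r)%R.
    by apply: contra_not tc => tc i; rewrite mxE.
  exists i => //; rewrite indicE memNset//= /ball/= distrC.
  exact: ti.
rewrite (@ge0_integral_tuple_prod _ _ _ lebesgue_measure n
    (fun i y => (\1_(ball (x0 ord0 i) r) y)%:E)); last 2 first.
- move=> i; apply/measurable_EFinP; apply: measurable_indic.
  exact: measurable_ball.
- by move=> i x; rewrite lee_fin.
rewrite (eq_bigr (fun=> (r *+ 2)%:E)) => [|i _].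
  by rewrite prodEFin prodr_const card_ord mulr_natl.
rewrite integral_indic//; last exact: measurable_ball.
rewrite setIT; exact: lebesgue_measure_ball.
Qed.

Local Close Scope ereal_scope.

Lemma euclidean_norm_ge0 (x : Rn) : 0 <= euclidean_norm x.
Proof. exact: sqrtr_ge0. Qed.

Lemma coord_le_euclidean_norm (x : Rn) i : `|x ord0 i| <= euclidean_norm x.
Proof.
rewrite -sqrtr_sqr ler_sqrt; last by apply: sumr_ge0 => j _; exact: sqr_ge0.
by rewrite (bigD1 i)//= lerDl; apply: sumr_ge0 => j _; exact: sqr_ge0.
Qed.

Lemma euclidean_norm_le_sum (x : Rn) : euclidean_norm x <= \sum_(i < n) `|x ord0 i|.
Proof.
rewrite -[leRHS]ger0_norm ?sumr_ge0// -sqrtr_sqr ler_sqrt ?sqr_ge0//.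
elim: (index_enum _) => [|i l IH]; first by rewrite !big_nil expr0n.
rewrite !big_cons sqrrD real_normK ?num_real//.
apply: lerD => //; first by rewrite lerDl mulrn_wge0// mulr_ge0// sumr_ge0.
Qed.

Lemma euclidean_normN (x : Rn) : euclidean_norm (- x) = euclidean_norm x.
Proof. by congr Num.sqrt; apply: eq_bigr => i _; rewrite mxE sqrrN. Qed.

Lemma euclidean_norm_distC (x y : Rn) : euclidean_norm (x - y) = euclidean_norm (y - x).
Proof. by rewrite -euclidean_normN opprB. Qed.

Lemma euclidean_norm_eq0 (x : Rn) : (euclidean_norm x == 0) = (x == 0).
Proof.
apply/eqP/eqP => [x0|->]; last first.
  by rewrite /euclidean_norm big1 ?sqrtr0// => i _; rewrite mxE expr0n.
apply/rowP => i; apply/eqP; rewrite mxE -normr_le0 -x0.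
exact: coord_le_euclidean_norm.
Qed.

(* The discriminant of t |-> |x + t y|^2 gives Cauchy-Schwarz. *)
Lemma ler_euclidean_normD (x y : Rn) :
  euclidean_norm (x + y) <= euclidean_norm x + euclidean_norm y.
Proof.
set a := \sum_(i < n) x ord0 i ^+ 2; set b := \sum_(i < n) y ord0 i ^+ 2.
pose c := \sum_(i < n) x ord0 i * y ord0 i.
have a0 : 0 <= a by apply: sumr_ge0 => i _; exact: sqr_ge0.
have b0 : 0 <= b by apply: sumr_ge0 => i _; exact: sqr_ge0.
have quad s t : 0 <= s ^+ 2 * a + 2 * s * t * c + t ^+ 2 * b.
  rewrite !mulr_sumr -!big_split/=; apply: sumr_ge0 => i _.
  rewrite [leRHS](_ : _ = (s * x ord0 i + t * y ord0 i) ^+ 2) ?sqr_ge0//; ring.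
have cs : c <= Num.sqrt a * Num.sqrt b.
  rewrite -sqrtrM//; apply: le_trans (ler_norm _) _; rewrite -sqrtr_sqr ler_sqrt ?mulr_ge0//.
  have [b_eq0|bn0] := eqVneq b 0.
    (* With [b = 0] the form takes the value [- c ^+ 2 * (a + 2)] at [(c, -1 - a)], which forces
       [c = 0]. *)
    have := quad 1 (- c * (a + 1)); have := quad c (-1 - a); rewrite b_eq0; nra.
  have {bn0}b_gt0 : 0 < b by rewrite lt_neqAle eq_sym bn0.
  have := quad b (- c).
  rewrite [leRHS](_ : _ = b * (a * b - c ^+ 2)); last by ring.
  by rewrite pmulr_rge0// subr_ge0.
rewrite -[leRHS]ger0_norm ?addr_ge0 ?sqrtr_ge0// -sqrtr_sqr ler_sqrt ?sqr_ge0//.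
rewrite sqrrD /euclidean_norm !sqr_sqrtr// -/a -/b.
rewrite [leLHS](_ : _ = a + c *+ 2 + b); last first.
  rewrite /a /b /c -sumrMnl -!big_split/=; apply: eq_bigr => i _.
  by rewrite mxE sqrrD.
by rewrite lerD2r lerD2l lerMn2r.
Qed.

Lemma ler_euclidean_dist (z x y : Rn) :
  euclidean_norm (x - y) <= euclidean_norm (x - z) + euclidean_norm (z - y).
Proof. by rewrite -[x - y](subrKA z) ler_euclidean_normD. Qed.

Lemma measurable_euclidean_dist (x0 : Rn) :
  measurable_fun setT (fun x : Rn => euclidean_norm (x - x0)).
Proof.
apply: (measurableT_comp (continuous_measurable_fun (@sqrt_continuous R))).
apply: measurable_sum => i.
under eq_fun do rewrite 2!mxE; apply: measurable_funX.
by apply: measurable_funB => //; exact: measurable_coor.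
Qed.

Lemma measurable_euclidean_ball (x0 : Rn) r : measurable (euclidean_ball x0 r).
Proof.
rewrite -[X in measurable X]setTI.
rewrite /euclidean_ball.
apply: (@measurable_fun_ltr _ _ _ _ (fun x : Rn => euclidean_norm (x - x0)) (cst r)) => //.
exact: measurable_euclidean_dist.
Qed.

Lemma le_lebesgue_rV_ball (x0 : Rn) r : 0 <= r ->
  (lebesgue_rV (euclidean_ball x0 r) <= ((2 * r) ^+ n)%:E)%E.
Proof.
move=> r0; rewrite -(lebesgue_rV_cube x0 r0); apply: le_measure.
- by rewrite inE; exact: measurable_euclidean_ball.
- by rewrite inE; exact: measurable_cube.
- move=> x xr i; apply: le_lt_trans xr.
  by have := coord_le_euclidean_norm (x - x0) i; rewrite 2!mxE.
Qed.

Lemma ge_lebesgue_rV_ball (x0 : Rn) r : (0 < n)%N -> 0 <= r ->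
  (((2 * r / n%:R) ^+ n)%:E <= lebesgue_rV (euclidean_ball x0 r))%E.
Proof.
move=> n0 r0; rewrite -mulrA -(lebesgue_rV_cube x0) ?divr_ge0//; apply: le_measure.
- by rewrite inE; exact: measurable_cube.
- by rewrite inE; exact: measurable_euclidean_ball.
- move=> x xr; apply: le_lt_trans (euclidean_norm_le_sum _) _.
  apply: (@lt_le_trans _ _ (\sum_(i < n) r / n%:R)).
    apply: ltr_sum; first by apply/hasP; exists (Ordinal n0); rewrite ?mem_index_enum.
    by move=> i _; rewrite 2!mxE; exact: xr.
  by rewrite sumr_const card_ord -[X in X <= _]mulr_natr divfK// pnatr_eq0 -lt0n.
Qed.

End lebesgue_rV_theory.

(** * Calderon-Zygmund kernels *)

(* Keeps unification from unfolding these measures into pushforwards. *)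
Opaque lebesgue_rV tuple_measure.

Section cz_kernel_theory.
Context (R : realType) (m n : nat).
Local Notation Rn := 'rV[R]_n.
Local Notation dist x y := (euclidean_norm (x - y)).

Lemma dist_le_dist_sum (y : m.+1.-tuple Rn) k l :
  dist (tnth y k) (tnth y l) <= dist_sum y.
Proof.
rewrite /dist_sum (bigD1 k)//= (bigD1 l)//= -addrA lerDl addr_ge0//.
  by apply: sumr_ge0 => i _; exact: euclidean_norm_ge0.
by apply: sumr_ge0 => i _; apply: sumr_ge0 => j _; exact: euclidean_norm_ge0.
Qed.

(** Triangle inequality through the [i]-th component. It bounds from below the maximum in the
    regularity condition, whichever component is being moved, by the distance of two fixed
    components. *)
Lemma max_dist_ge (y : m.+1.-tuple Rn) i a b :
  dist (tnth y a) (tnth y b) <=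
  2 * \big[Num.max/0]_(k < m.+1) dist (tnth y i) (tnth y k).
Proof.
have mx k : dist (tnth y i) (tnth y k) <=
    \big[Num.max/0]_(k < m.+1) dist (tnth y i) (tnth y k).
  exact: (le_bigmax _ (fun k => dist (tnth y i) (tnth y k))).
apply: le_trans (ler_euclidean_dist (tnth y i) _ _) _.
by rewrite euclidean_norm_distC mulr_natl mulr2n lerD.
Qed.

(* Continuity off the diagonal: change the coordinates one at a time. *)
Lemma cz_kernel_continuous (K : m.+1.-tuple Rn -> R) (y : m.+1.-tuple Rn) (e : R) :
  cz_kernel K -> off_diagonal y -> 0 < e ->
  exists2 delta : R, 0 < delta & forall z : m.+1.-tuple Rn,
    (forall i, dist (tnth y i) (tnth z i) <= delta) -> `|K y - K z| <= e.
Proof.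
move=> [C [eps [C0 eps0 _ Kreg]]] [a [b yab]] e0.
pose d := dist (tnth y a) (tnth y b).
have d0 : 0 < d.
  by rewrite lt_neqAle eq_sym euclidean_norm_eq0 subr_eq0 yab euclidean_norm_ge0.
pose D := (d / 4) `^ ((m * n)%:R + eps).
have D0 : 0 < D by rewrite powR_gt0// divr_gt0.
pose A := e * D / (C * m.+1%:R).
have A0 : 0 < A by rewrite divr_gt0 ?mulr_gt0.
(* The bound [d / 8] keeps components [a] and [b] at least [3 / 4 * d] apart in every intermediate
   tuple. The maximum in the regularity condition is then at least [3 / 8 * d], half of which
   exceeds the displacement, and [D] bounds the denominator from below. The bound through [A] makes
   each of the [m.+1] changes cost at most [e / m.+1]. *)
exists (Num.min (d / 8) (A `^ eps^-1)).
  by rewrite lt_min powR_gt0// andbT divr_gt0.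
move=> z; set delta := Num.min _ _ => yz.
have delta0 : 0 <= delta by apply: le_trans (yz a); exact: euclidean_norm_ge0.
have delta8 : delta <= d / 8 by rewrite ge_min lexx.
have deltaA : delta `^ eps <= A.
  apply: (@le_trans _ _ ((A `^ eps^-1) `^ eps)).
    apply: ge0_ler_powR; rewrite ?nnegrE ?powR_ge0 ?ge_min ?lexx ?orbT//; exact: ltW.
  by rewrite -powRrM mulVf ?gt_eqF// powRr1// ltW.
pose hyb (j : nat) := [tuple if (i < j)%N then tnth z i else tnth y i | i < m.+1].
have near_y (w : m.+1.-tuple Rn) : (forall i, dist (tnth y i) (tnth w i) <= delta) ->
    3 / 4 * d <= dist (tnth w a) (tnth w b).
  move=> yw; have := ler_euclidean_dist (tnth w a) (tnth y a) (tnth y b).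
  have := ler_euclidean_dist (tnth w b) (tnth w a) (tnth y b).
  have := yw a; have := yw b; rewrite -/d (euclidean_norm_distC (tnth y b)); lra.
have hyb_y j i : dist (tnth y i) (tnth (hyb j) i) <= delta.
  rewrite tnth_mktuple; case: ifPn => // _; rewrite subrr.
  by have /eqP -> : euclidean_norm (0 : Rn) == 0 by rewrite euclidean_norm_eq0.
have step (j : 'I_m.+1) : `|K (hyb j) - K (hyb j.+1)| <= e / m.+1%:R.
  have -> : hyb j.+1 = replace_tnth (hyb j) j (tnth z j).
    apply: eq_from_tnth => i; rewrite !tnth_mktuple ltnS leq_eqVlt.
    have [->|ij] := eqVneq i j; first by rewrite eqxx.
    by rewrite (negbTE (ij : (i : nat) != j)).
  have hj : tnth (hyb j) j = tnth y j by rewrite tnth_mktuple ltnn.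
  have hab := near_y _ (hyb_y j).
  apply: le_trans (Kreg _ _ _ _ _) _.
  - exists a, b; apply/eqP => hE; move: hab; rewrite hE subrr.
    have /eqP -> : euclidean_norm (0 : Rn) == 0 by rewrite euclidean_norm_eq0.
    lra.
  - rewrite {1}hj; have := max_dist_ge (hyb j) j a b; have := yz j; lra.
  - rewrite ler_pdivrMr; last first.
      rewrite powR_gt0//; apply: lt_le_trans (dist_le_dist_sum _ a b); lra.
    apply: (@le_trans _ _ (e / m.+1%:R * D)); last first.
      apply: ler_wpM2l; first by rewrite divr_ge0// ltW.
      have hd := dist_le_dist_sum (hyb j) a b.
      apply: ge0_ler_powR; rewrite ?nnegrE; last by lra.
      + by rewrite addr_ge0// ltW.
      + by lra.
      + by lra.
    apply: (@le_trans _ _ (C * A)).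
      apply: ler_wpM2l; first exact: ltW.
      apply: le_trans deltaA; rewrite hj.
      by apply: ge0_ler_powR; rewrite ?nnegrE ?euclidean_norm_ge0// ltW.
    have : m.+1%:R != 0 :> R by rewrite pnatr_eq0.
    rewrite /A; move: (m.+1%:R : R) => N N0; rewrite le_eqVlt; apply/orP; left; apply/eqP.
    by field; rewrite N0 gt_eqF.
have tele j : (j <= m.+1)%N -> `|K y - K (hyb j)| <= j%:R * (e / m.+1%:R).
  elim: j => [_|j IH jm].
    rewrite (_ : hyb 0%N = y) ?subrr ?normr0 ?mul0r//.
    by apply: eq_from_tnth => i; rewrite tnth_mktuple.
  rewrite -[K y - _](subrKA (K (hyb j))) (le_trans (ler_normD _ _))//.
  by rewrite mulrSr mulrDl mul1r lerD ?IH ?(ltnW jm)//; exact: (step (Ordinal jm)).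
have := tele _ (leqnn _); rewrite (_ : hyb m.+1 = z).
  by rewrite mulrC divfK// pnatr_eq0.
by apply: eq_from_tnth => i; rewrite tnth_mktuple ltn_ord.
Qed.

(** Since |x - x0| < r and r is at most half of |y_j - x0|, the distance |x - y_j| is at least half
    of |y_j - x0|. It is one of the terms of [dist_sum], and the factor 2^(mn) absorbs the half. *)
Lemma cz_kernel_le (K : m.+1.-tuple Rn -> R) : cz_kernel K ->
  exists2 C : R, 0 < C & forall (x0 x : Rn) (r : R) (y : m.-tuple Rn) (j : 'I_m),
    euclidean_ball x0 r x -> 0 < r -> 2 * r <= dist (tnth y j) x0 ->
    `|K [tuple of x :: y]| <= C / dist (tnth y j) x0 ^+ (m * n).
Proof.
move=> [C [eps [C0 eps0 Ksize _]]]; exists (2 ^+ (m * n) * C) => [|x0 x r y j xr r0 rj].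
  by rewrite mulr_gt0// exprn_gt0.
set D := dist _ _ in rj *; have D0 : 0 < D by lra.
have dist_sumD : D / 2 <= dist_sum [tuple of x :: y].
  apply: le_trans (dist_le_dist_sum _ ord0 (lift ord0 j)).
  rewrite tnth0 tnthS; have := ler_euclidean_dist x (tnth y j) x0.
  rewrite -/D (euclidean_norm_distC _ x); move: xr; rewrite /euclidean_ball /=; lra.
have dist_sum0 : 0 < dist_sum [tuple of x :: y] by lra.
apply: le_trans (Ksize _ _) _.
  exists ord0, (lift ord0 j); rewrite tnth0 tnthS; apply/eqP => xE.
  by move: rj; rewrite /D -xE; move: xr; rewrite /euclidean_ball /=; lra.
rewrite ler_pdivrMr ?exprn_gt0// mulrAC ler_pdivlMr ?exprn_gt0//.
rewrite [leRHS](_ : _ = C * (2 * dist_sum [tuple of x :: y]) ^+ (m * n)); last first.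
  by rewrite exprMn; ring.
by rewrite ler_wpM2l ?(ltW C0)// lerXn2r// ?nnegrE; lra.
Qed.

End cz_kernel_theory.

(** A preimage is a countable union of fibres of [h], so [F] may be arbitrary. Here [F] will be the
    kernel evaluated at grid points, about whose measurability nothing is known yet. *)
Lemma measurable_fun_countable d d' (X : measurableType d) (Y : measurableType d')
    (Z : countType) (h : X -> Z) (F : Z -> Y) :
  (forall c, measurable (h @^-1` [set c])) -> measurable_fun setT (F \o h).
Proof.
move=> mh _ B _; rewrite setTI.
rewrite (_ : _ @^-1` B = \bigcup_(c : Z) (h @^-1` [set c] `&` [set x | B (F c)])).
  apply: countable_bigcupT_measurable => // c; apply: measurableI => //.
  have [Bc|Bc] := pselect (B (F c)).
    by rewrite (_ : [set _ | _] = setT)//; apply/seteqP; split.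
  by rewrite (_ : [set _ | _] = set0)//; apply/seteqP; split.
apply/seteqP; split => [x Bx|x [c _ [<-]]//].
by exists (h x).
Qed.

Section grid.
Context (R : realType) (m n : nat).
Local Notation Rn := 'rV[R]_n.

Let code (N : nat) (y : m.-tuple Rn) : {ffun 'I_m * 'I_n -> int} :=
  [ffun ij => Num.floor (N.+1%:R * tnth y ij.1 ord0 ij.2)].

Let decode (N : nat) (c : {ffun 'I_m * 'I_n -> int}) : m.-tuple Rn :=
  [tuple \row_j ((c (i, j))%:~R / N.+1%:R) | i < m].

Lemma measurable_tnth_coor (i : 'I_m) (j : 'I_n) :
  measurable_fun setT (fun y : m.-tuple Rn => tnth y i ord0 j).
Proof. exact: (measurableT_comp (measurable_coor j) (measurable_tnth i)). Qed.

Let measurable_code N c : measurable (code N @^-1` [set c]).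
Proof.
rewrite (_ : _ @^-1` _ = \bigcap_(ij in [set: 'I_m * 'I_n])
    ((fun y : m.-tuple Rn => N.+1%:R * tnth y ij.1 ord0 ij.2)
      @^-1` `[(c ij)%:~R, (c ij + 1)%:~R[)).
  apply: fin_bigcap_measurable => // ij _; rewrite -[X in measurable X]setTI.
  have : measurable_fun setT (fun y : m.-tuple Rn => N.+1%:R * tnth y ij.1 ord0 ij.2).
    by apply: measurable_funM => //; exact: measurable_tnth_coor.
  by apply => //; exact: measurable_itv.
apply/seteqP; split => [y /= <- ij _ /=|y yc].
  by rewrite in_itv/= ffunE floor_itv.
apply/ffunP => ij; rewrite ffunE; apply: floor_def.
by have := yc ij I; rewrite /= in_itv.
Qed.

Lemma code_dist N (y : m.-tuple Rn) i :
  euclidean_norm (tnth y i - tnth (decode N (code N y)) i) <= n%:R / N.+1%:R.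
Proof.
apply: le_trans (euclidean_norm_le_sum _) _.
rewrite mulrC mulr_natr -[X in _ <= _ *+ X]card_ord -sumr_const; apply: ler_sum => j _.
rewrite tnth_mktuple !mxE ffunE /=.
set a := tnth y i ord0 j.
have N0 : (0 < N.+1%:R :> R) by [].
rewrite -(ler_pM2r N0) mulVf ?gt_eqF// -[X in _ * X <= _](gtr0_norm N0) -normrM.
rewrite mulrBl divfK ?gt_eqF// mulrC ger0_norm.
  by rewrite lerBlDl ltW//; have := floorD1_gt (N.+1%:R * a); rewrite intrD.
by rewrite subr_ge0 floor_le.
Qed.

Lemma measurable_tuple_set1 (y : m.-tuple Rn) : measurable [set y].
Proof.
rewrite (_ : [set y] = \bigcap_(ij in [set: 'I_m * 'I_n])
    ((fun z : m.-tuple Rn => tnth z ij.1 ord0 ij.2) @^-1` [set tnth y ij.1 ord0 ij.2])).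
  apply: fin_bigcap_measurable => // ij _; rewrite -[X in measurable X]setTI.
  exact: (measurable_tnth_coor ij.1 ij.2).
apply/seteqP; split => [z -> //|z zy].
by apply: eq_from_tnth => i; apply/rowP => j; exact: (zy (i, j)).
Qed.

(* The kernel is continuous in y off one point, hence the pointwise limit of
   its compositions with the roundings to the grids of mesh 1 / (N + 1). *)
Lemma measurable_cz_kernel (K : m.+1.-tuple Rn -> R) (x : Rn) : cz_kernel K ->
  measurable_fun setT (fun y : m.-tuple Rn => K [tuple of x :: y]).
Proof.
(* [diag] is the only [y] for which [(x, y)] lies on the diagonal, where the kernel is
   unconstrained. The approximations [g N] take the exact value there, so convergence has to be
   proved only at the other points. *)
move=> kerK; pose diag : m.-tuple Rn := [tuple x | i < m].
pose g N (y : m.-tuple Rn) := if y \in [set diag] then K [tuple of x :: diag]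
  else ((fun c => K [tuple of x :: decode N c]) \o code N) y.
apply: (@measurable_fun_cvg _ _ _ _ g) => [N|y _].
  apply: measurable_fun_ifT => //.
    apply: (measurable_fun_bool true); rewrite setTI preimage_mem_true.
    exact: measurable_tuple_set1.
  by apply: measurable_fun_countable; exact: measurable_code.
have [->|yd] := eqVneq y diag.
  rewrite (_ : g^~ diag = cst (K [tuple of x :: diag])); first exact: cvg_cst.
  by apply/funext => N; rewrite /g mem_set.
have offy : off_diagonal [tuple of x :: y].
  have /existsNP[i yi] : ~ forall i, tnth y i = x.
    apply: contra_not (elimN eqP yd) => yx.
    by apply: eq_from_tnth => i; rewrite tnth_mktuple yx.
  by exists ord0, (lift ord0 i); rewrite tnth0 tnthS; apply/eqP => /esym.
apply/cvgrPdist_le => /= e e0.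
have [delta delta0 Kd] := cz_kernel_continuous kerK offy e0.
near=> N; rewrite /g memNset/=; last exact/eqP.
apply: Kd => i; case: (unliftP ord0 i) => [j ->|->].
  rewrite !tnthS; apply: le_trans (code_dist _ _ _) _.
  rewrite ler_pdivrMr// mulrC -ler_pdivrMr//.
  apply: (@le_trans _ _ N%:R); last by rewrite ler_nat.
  by near: N; exact: nbhs_infty_ger.
rewrite !tnth0 subrr.
have /eqP -> : euclidean_norm (0 : Rn) == 0 by rewrite euclidean_norm_eq0.
exact: ltW.
Unshelve. all: by end_near. Qed.

End grid.

(** * Norms over a set *)

Section Lnorm_on_theory.
Context (R : realType) (n : nat).
Local Notation Rn := 'rV[R]_n.
Implicit Types (f g : Rn -> R) (B : set Rn).

Lemma measurable_patch B f : measurable B -> measurable_fun setT f ->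
  measurable_fun setT (f \_ B).
Proof.
move=> mB mf; apply/(measurable_restrict f mB measurableT).
exact: measurable_funTS.
Qed.

Lemma norm_patch B f x : `|(f \_ B) x| = ((fun y => `|f y|) \_ B) x.
Proof. by rewrite !patchE; case: ifPn => // _; rewrite normr0. Qed.

Lemma Lnorm_on_ge0 p B f : (0 <= Lnorm_on p B f)%E.
Proof. exact: Lnorm_ge0. Qed.

Lemma le_Lnorm_on p A B f : 0 <= p -> A `<=` B -> (Lnorm_on p A f <= Lnorm_on p B f)%E.
Proof.
move=> p0 AB; apply: le_Lnorm_nomeas => // x; rewrite !patchE.
case: ifPn => [/set_mem/AB xB|_]; first by rewrite mem_set.
by rewrite normr0.
Qed.

Lemma Lnorm_on_cst p B (c : R) : 0 < p -> measurable B ->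
  (Lnorm_on p B (fun=> c) = `|c|%:E * lebesgue_rV B `^ p^-1)%E.
Proof.
move=> p0 mB; rewrite /Lnorm_on unlock.
rewrite (eq_integral (fun x => ((`|c| `^ p)%:E * (\1_B x)%:E)%E)); last first.
  move=> x _ /=; rewrite norm_patch patchE indicE; case: ifPn => _.
    by rewrite mule1.
  by rewrite powR0 ?gt_eqF// mule0.
rewrite ge0_integralZl_EFin ?powR_ge0//; first last.
  by apply/measurable_EFinP; apply: measurable_indic.
rewrite integral_indic// setIT poweRM ?lee_fin ?powR_ge0//.
by rewrite poweR_EFin -powRrM divff ?gt_eqF// powRr1.
Qed.

Lemma Lnorm_onE p B f : p != 0 ->
  (Lnorm_on p B f = (\int[lebesgue_rV]_(x in B) (`|f x| `^ p)%:E) `^ p^-1)%E.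
Proof.
move=> p0; rewrite /Lnorm_on unlock; congr (_ `^ _)%E.
rewrite [RHS]integral_mkcond; apply: eq_integral => x _ /=.
by rewrite norm_patch !patchE; case: ifPn => // _; rewrite powR0.
Qed.

Lemma Lnorm_onD p B f g : 1 <= p -> measurable B ->
  measurable_fun setT f -> measurable_fun setT g ->
  (Lnorm_on p B (f \+ g)%R <= Lnorm_on p B f + Lnorm_on p B g)%E.
Proof.
move=> p1 mB mf mg.
have := @minkowski_EFin _ _ _ lebesgue_rV _ _ p (measurable_patch mB mf)
  (measurable_patch mB mg) p1.
apply: le_trans; rewrite le_eqVlt; apply/orP; left; apply/eqP; congr Lnorm.
apply/funext => x /=; congr EFin; rewrite !patchE; case: ifPn => // _.
by rewrite /= addr0.
Qed.

Lemma euclidean_ball_compact x0 r : exists2 A : set Rn, compact A & euclidean_ball x0 r `<=` A.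
Proof.
exists [set v : Rn | forall i, `[x0 ord0 i - r, x0 ord0 i + r]%classic (v ord0 i)].
  apply: (@rV_compact R n (fun i => `[x0 ord0 i - r, x0 ord0 i + r]%classic)) => i.
  exact: segment_compact.
move=> x xr i; have := coord_le_euclidean_norm (x - x0) i.
rewrite !mxE /= in_itv/=; move: xr; rewrite /euclidean_ball/= => xr xi.
by have := le_trans xi (ltW xr); rewrite ler_distl.
Qed.

Lemma Lloc_ball p f x0 r : 0 <= p -> Lloc p f -> (Lnorm_on p (euclidean_ball x0 r) f < +oo)%E.
Proof.
move=> p0 [_ fin]; have [A cA BA] := euclidean_ball_compact x0 r.
by apply: le_lt_trans (fin _ cA); exact: le_Lnorm_on.
Qed.

(** The indicator of [B] serves as an additional factor, whose exponent [r0] fills the gap between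
    [p^-1] and the sum of the [(q i)^-1]; its norm is the power of the volume on the right. *)
Lemma hoelder_on (I : finType) (q : I -> R) (p r0 : R) B (g : I -> Rn -> R) :
  measurable B -> (forall i, measurable_fun setT (g i)) ->
  0 < p -> 0 < r0 -> (forall i, 0 < q i) -> p^-1 = r0^-1 + \sum_i (q i)^-1 ->
  (Lnorm_on p B (fun x => \prod_i g i x)%R <=
   lebesgue_rV B `^ r0^-1 * \prod_i Lnorm_on (q i) B (g i))%E.
Proof.
move=> mB mg p0 r00 q0 pE.
have := @generalized_hoelder_prod _ _ _ lebesgue_rV I (index_enum I) xpredT q p r0
  ((fun=> 1 : R) \_ B) (fun i => g i \_ B) (measurable_patch mB (measurable_cst _))
  (fun i => measurable_patch mB (mg i)) p0 r00 q0 pE.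
rewrite -/(Lnorm_on _ _ _) Lnorm_on_cst// normr1 mul1e; apply: le_trans.
rewrite le_eqVlt; apply/orP; left; apply/eqP; congr Lnorm.
apply/funext => x /=; congr EFin; rewrite !patchE; case: ifPn => xB.
  by rewrite /= mul1r; apply: eq_bigr => i _; rewrite patchE xB.
by rewrite mul0r.
Qed.

Lemma hoelder_on2 (q1 q2 r0 : R) B f g : measurable B ->
  measurable_fun setT f -> measurable_fun setT g ->
  0 < r0 -> 0 < q1 -> 0 < q2 -> 1 = r0^-1 + q1^-1 + q2^-1 ->
  (\int[lebesgue_rV]_(x in B) (`|f x * g x|)%:E <=
   lebesgue_rV B `^ r0^-1 * (Lnorm_on q1 B f * Lnorm_on q2 B g))%E.
Proof.
move=> mB mf mg r00 q10 q20 E.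
have mfg (b : bool) : measurable_fun setT (if b then f else g) by case: b.
have q120 (b : bool) : 0 < (if b then q1 else q2) by case: b.
have E' : 1^-1 = r0^-1 + \sum_(b : bool) (if b then q1 else q2)^-1.
  by rewrite big_bool/= addrA invr1.
have := hoelder_on mB mfg ltr01 r00 q120 E'; rewrite big_bool/=; apply: le_trans.
rewrite Lnorm_onE ?oner_eq0// invr1 poweRe1; last first.
  by apply: integral_ge0 => x _; rewrite lee_fin powR_ge0.
by apply: ge0_le_integral_nomeas => x _; rewrite ?lee_fin// big_bool/= powRr1.
Qed.

Lemma hoelder_on1 (q : R) B f : measurable B -> measurable_fun setT f -> 1 < q ->
  (\int[lebesgue_rV]_(x in B) (`|f x|)%:E <=
   lebesgue_rV B `^ (1 - q^-1) * Lnorm_on q B f)%E.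
Proof.
move=> mB mf q1; have q0 : 0 < q by apply: lt_trans q1.
have r0 : 0 < 1 - q^-1 by rewrite subr_gt0 invf_lt1.
have r0' : 0 < (1 - q^-1)^-1 by rewrite invr_gt0.
have E : 1^-1 = (1 - q^-1)^-1^-1 + \sum_(b : unit) q^-1.
  by rewrite sumr_const card_unit mulr1n invrK subrK invr1.
have := hoelder_on mB (fun _ : unit => mf) ltr01 r0' (fun=> q0) E.
rewrite big_const card_unit /= mule1 invrK; apply: le_trans.
rewrite Lnorm_onE ?oner_eq0// invr1 poweRe1; last first.
  by apply: integral_ge0 => x _; rewrite lee_fin powR_ge0.
apply: ge0_le_integral_nomeas => x _; rewrite ?lee_fin//.
by rewrite prodr_const card_unit expr1 powRr1.
Qed.

End Lnorm_on_theory.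

(** * Local Campanato spaces *)

Section campanato_theory.
Context (R : realType) (n : nat) (n_gt0 : (0 < n)%N).
Local Notation Rn := 'rV[R]_n.
Variable x0 : Rn.
Local Notation B r := (euclidean_ball x0 r).
Local Notation vol r := (fine (lebesgue_rV (euclidean_ball x0 r))).
Implicit Types (b : Rn -> R) (r s t q lam : R).

Let N0 : 0 < n%:R :> R. Proof. by rewrite ltr0n. Qed.

Lemma volE r : 0 <= r -> lebesgue_rV (B r) = (vol r)%:E.
Proof.
move=> r0; rewrite fineK// ge0_fin_numE//.
by apply: le_lt_trans (le_lebesgue_rV_ball _ r0) _; rewrite ltry.
Qed.

Lemma vol_le r : 0 <= r -> vol r <= (2 * r) ^+ n.
Proof. by move=> r0; rewrite -lee_fin -volE// le_lebesgue_rV_ball. Qed.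

Lemma vol_ge r : 0 <= r -> (2 * r / n%:R) ^+ n <= vol r.
Proof. by move=> r0; rewrite -lee_fin -volE// ge_lebesgue_rV_ball. Qed.

Lemma vol_gt0 r : 0 < r -> 0 < vol r.
Proof.
by move=> r0; apply: lt_le_trans (vol_ge (ltW r0)); rewrite exprn_gt0// divr_gt0// mulr_gt0.
Qed.

Lemma vol_powR_le r (e : R) : 0 <= e -> 0 < r ->
  vol r `^ e <= 2 `^ (n%:R * e) * r `^ (n%:R * e).
Proof.
move=> e0 r0; rewrite -powRM ?(ltW r0)// powRrM; apply: ge0_ler_powR => //.
- by rewrite nnegrE ltW// vol_gt0.
- by rewrite nnegrE powR_ge0.
- by rewrite powR_mulrn ?vol_le ?mulr_ge0// ltW.
Qed.

Lemma vol_powR_ge r (e : R) : 0 <= e -> 0 < r ->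
  (2 / n%:R) `^ (n%:R * e) * r `^ (n%:R * e) <= vol r `^ e.
Proof.
move=> e0 r0; rewrite -powRM ?(ltW r0)// ?divr_ge0// powRrM; apply: ge0_ler_powR => //.
- by rewrite nnegrE powR_ge0.
- by rewrite nnegrE ltW// vol_gt0.
- rewrite mulrAC powR_mulrn ?divr_ge0 ?mulr_ge0 ?(ltW r0)//.
  by rewrite vol_ge// ltW.
Qed.

Lemma campanato_norm_ge0 q lam b : (0 <= campanato_norm x0 q lam b)%E.
Proof.
apply: ereal_sup_ge => /=; eexists; first by exists 1; [exact: ltr01|reflexivity].
exact: poweR_ge0.
Qed.

Lemma campanato_normE q lam b : campanato x0 q lam b ->
  campanato_norm x0 q lam b = (fine (campanato_norm x0 q lam b))%:E.
Proof. by move=> [_ ?]; rewrite fineK// ge0_fin_numE// campanato_norm_ge0. Qed.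

(** One radius of the supremum, solved for the norm: the volume gets the exponent
    [(1 + lam * q) / q = q^-1 + lam]. *)
Lemma Lnorm_on_campanato q lam b r : 0 < q -> campanato x0 q lam b -> 0 < r ->
  (Lnorm_on q (B r) (fun y => b y - average (B r) b)%R <=
   (vol r `^ (q^-1 + lam) * fine (campanato_norm x0 q lam b))%:E)%E.
Proof.
move=> q0 bC r0; rewrite EFinM -campanato_normE// Lnorm_onE ?gt_eqF//.
set J := (\int[_]_(y in _) _)%E; have J0 : (0 <= J)%E.
  by apply: integral_ge0 => x _; rewrite lee_fin powR_ge0.
have v0 := vol_gt0 r0.
have -> : (J `^ q^-1 = (vol r `^ (q^-1 + lam))%:E *
    ((vol r `^ (1 + lam * q))^-1%:E * J) `^ q^-1)%E.
  rewrite poweRM ?lee_fin ?invr_ge0 ?powR_ge0// muleA poweR_EFin -EFinM.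
  rewrite -powRN -powRrM -powRD_gt0//.
  rewrite (_ : _ + _ = 0) ?powRr0 ?mul1e//.
  by field; rewrite gt_eqF.
apply: lee_wpmul2l; first by rewrite lee_fin powR_ge0.
by apply: ereal_sup_ubound; exists r.
Qed.

(** The left side is the average of [b - c], and Hoelder's inequality against the constant 1 gives
    the volume to the power [(1 - q^-1) - 1]. Local integrability of [b] is what allows the constant
    to enter the integral. *)
Lemma average_sub_le q b s c : 1 < q -> Lloc q b -> 0 < s ->
  (`|average (B s) b - c|%:E <=
    (vol s `^ (- q^-1))%:E * Lnorm_on q (B s) (fun y => b y - c)%R)%E.
Proof.
move=> q1 bl s0; have q0 : 0 < q by apply: lt_trans q1.
have [mb _] := bl; have v0 := vol_gt0 s0.
have mB := measurable_euclidean_ball x0 s.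
have mbc : measurable_fun setT (fun y => b y - c) by apply: measurable_funB.
have VE := volE (ltW s0).
have ib : lebesgue_rV.-integrable (B s) (EFin \o b).
  apply/integrableP; split; first by apply/measurable_EFinP; exact: measurable_funTS.
  apply: le_lt_trans (hoelder_on1 mB mb q1) _.
  rewrite VE poweR_EFin lte_mul_pinfty ?lee_fin ?powR_ge0//.
  exact: Lloc_ball (ltW q0) bl.
have ic : lebesgue_rV.-integrable (B s) (EFin \o (fun=> c)).
  apply/integrableP; split; first exact: measurable_cst.
  by rewrite /= integral_cst// [X in (_ * X)%E]VE ltry.
have ibc : lebesgue_rV.-integrable (B s) (EFin \o (fun y => b y - c)).
  by have := integrableB mB ib ic; apply: eq_integrable.
have -> : average (B s) b - c = (vol s)^-1 * \int[lebesgue_rV]_(y in B s) (b y - c).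
  rewrite RintegralB// Rintegral_cst// mulrBr; congr (_ - _).
  by rewrite mulrCA mulVf ?mulr1// gt_eqF.
rewrite normrM (gtr0_norm (_ : 0 < (vol s)^-1)) ?invr_gt0// EFinM.
apply: (@le_trans _ _ ((vol s)^-1%:E *
    ((vol s `^ (1 - q^-1))%:E * Lnorm_on q (B s) (fun y => b y - c)%R)))%E.
  apply: lee_wpmul2l; first by rewrite lee_fin invr_ge0 ltW.
  rewrite -poweR_EFin -VE; apply: le_trans (hoelder_on1 mB mbc q1).
  apply: le_trans (_ : (_ <= (\int[lebesgue_rV]_(y in B s) `|b y - c|)%:E)%E) _.
    by rewrite lee_fin; exact: le_normr_Rintegral.
  rewrite /Rintegral fineK//; apply: integrable_fin_num => //.
  exact: (integrable_abse ibc).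
rewrite muleA -EFinM -[X in (X * _ `^ _)]powR_inv1 ?(ltW v0)//.
rewrite -powRD_gt0//.
by rewrite addrA addNr add0r.
Qed.

End campanato_theory.

Section campanato_oscillation.
Context (R : realType) (n : nat) (n_gt0 : (0 < n)%N).
Local Notation Rn := 'rV[R]_n.
Variables (q lam : R) (q_gt1 : 1 < q) (lam_gt0 : 0 < lam).
Local Notation B x0 r := (euclidean_ball x0 r).
Local Notation vol x0 r := (fine (lebesgue_rV (euclidean_ball x0 r))).
Local Notation beta x0 b := (fine (campanato_norm x0 q lam b)).
Implicit Types (b : Rn -> R) (r s t : R).

Let q_gt0 : 0 < q. Proof. exact: lt_trans q_gt1. Qed.
Let qV_ge0 : 0 <= q^-1. Proof. by rewrite invr_ge0 ltW. Qed.
Let n0 : 0 < n%:R :> R. Proof. by rewrite ltr0n. Qed.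

(** The average over the large ball is taken as the constant on the small one, and the norm is then
    enlarged to the large ball. The quotient of the two volumes is harmless because [t <= 2 * s]. *)
Lemma average_double : exists2 A : R, 0 < A & forall (x0 : Rn) b s t,
  campanato x0 q lam b -> 0 < s -> s <= t <= 2 * s ->
  `|average (B x0 s) b - average (B x0 t) b| <= A * t `^ (n%:R * lam) * beta x0 b.
Proof.
set E := q^-1 + lam; have E0 : 0 <= E by rewrite addr_ge0// ltW.
set u := (2 / n%:R : R) `^ (n%:R * q^-1).
have u0 : 0 < u by rewrite powR_gt0// divr_gt0.
(* The first factor comes from the upper bound for the volume of [B x0 t], the division by [u] from
   the lower bound for that of [B x0 s], and the middle factor from [t <= 2 * s]. *)
exists (2 `^ (n%:R * E) * 2 `^ (n%:R * q^-1) / u).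
  by rewrite divr_gt0// mulr_gt0// powR_gt0.
move=> x0 b s t bC s0 /andP[st ts]; have t0 : 0 < t by apply: lt_le_trans st.
have [bl _] := bC; have b0 : 0 <= beta x0 b by rewrite fine_ge0 ?campanato_norm_ge0.
have vs := vol_gt0 n_gt0 x0 s0.
have Bst : B x0 s `<=` B x0 t.
  by move=> y; rewrite /euclidean_ball/= => /lt_le_trans; exact.
rewrite -lee_fin.
apply: (@le_trans _ _ ((vol x0 s `^ (- q^-1))%:E *
    (vol x0 t `^ E * beta x0 b)%:E)%E).
  apply: le_trans (average_sub_le n_gt0 x0 _ q_gt1 bl s0) _.
  apply: lee_wpmul2l; first by rewrite lee_fin powR_ge0.
  apply: le_trans (le_Lnorm_on _ (ltW q_gt0) Bst) _.
  exact: (Lnorm_on_campanato n_gt0 q_gt0 bC t0).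
rewrite -EFinM lee_fin mulrA ler_wpM2r// powRN ler_pdivrMl ?powR_gt0//.
apply: le_trans (vol_powR_le n_gt0 x0 E0 t0) _.
apply: (@le_trans _ _ ((u * s `^ (n%:R * q^-1)) *
    (2 `^ (n%:R * E) * 2 `^ (n%:R / q) / u * t `^ (n%:R * lam)))); last first.
  apply: ler_wpM2r; last exact: vol_powR_ge.
  by rewrite !mulr_ge0 ?invr_ge0 ?powR_ge0.
rewrite [leRHS](_ : _ = 2 `^ (n%:R * E) *
    ((2 * s) `^ (n%:R / q) * t `^ (n%:R * lam))); last first.
  by rewrite powRM ?(ltW s0)//; field; rewrite gt_eqF.
apply: ler_wpM2l; first exact: powR_ge0.
rewrite {1}/E mulrDr powRD_gt0//; apply: ler_wpM2r; first exact: powR_ge0.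
apply: ge0_ler_powR => //; first by rewrite mulr_ge0.
- by rewrite nnegrE ltW.
- by rewrite nnegrE mulr_ge0// ltW.
Qed.

(* The bounds over dyadic radii form a geometric series as [lam > 0]. *)
Lemma average_far : exists2 A : R, 0 < A & forall (x0 : Rn) b s t,
  campanato x0 q lam b -> 0 < s -> s <= t ->
  `|average (B x0 s) b - average (B x0 t) b| <= A * t `^ (n%:R * lam) * beta x0 b.
Proof.
have [A A0 HA] := average_double.
pose rho : R := 2^-1 `^ (n%:R * lam).
have rho1 : rho < 1.
  have /= <- := congr1 (fun f => f (n%:R * lam)) (powR1 R).
  apply: gt0_ltr_powR; rewrite ?nnegrE//; first by rewrite mulr_gt0.
  by rewrite invf_lt1// ltr1n.
have rho0 : 0 < rho by rewrite powR_gt0.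
(* [A'] is the sum of the geometric series of ratio [rho], that is, the solution of
   [A' * rho + A = A']. This closes an induction that halves [t] until it is at most [2 * s]. *)
pose A' := A / (1 - rho); have A'0 : 0 < A' by rewrite divr_gt0// subr_gt0.
have AA' : A <= A'.
  by rewrite ler_pdivlMr ?subr_gt0// ger_pMr// lerBlDr lerDl ltW.
exists A' => // x0 b s t bC s0 st.
have b0 : 0 <= beta x0 b by rewrite fine_ge0 ?campanato_norm_ge0.
have [k tk] : exists k, t <= 2 ^+ k * s.
  exists (Num.bound (t / s)); rewrite -ler_pdivrMr//.
  apply: le_trans (ltW (archi_boundP _)) _; first by rewrite divr_ge0// ltW// (lt_le_trans s0).
  by rewrite -natrX ler_nat ltnW// ltn_expl.
elim: k => [|k IH] in t st tk *.
  rewrite (_ : t = s); last by apply/eqP; move: tk; rewrite expr0 mul1r eq_le st => ->.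
  rewrite subrr normr0; apply: mulr_ge0 => //.
  by apply: mulr_ge0; [exact: ltW|exact: powR_ge0].
have [ts|ts] := leP t (2 * s).
  apply: le_trans (HA x0 b s t bC s0 _) _; first by rewrite st ts.
  by rewrite !ler_wpM2r ?powR_ge0.
have st2 : s <= t / 2 by lra.
have := IH (t / 2) st2; rewrite ler_pdivrMr// mulrAC -exprSr => /(_ tk) IHk.
have t0 : 0 < t by lra.
have HAt : `|average (B x0 (t / 2)) b - average (B x0 t) b| <=
    A * t `^ (n%:R * lam) * beta x0 b.
  by apply: HA => //; [lra|apply/andP; split; lra].
rewrite -(subrKA (average (B x0 (t / 2)) b)).
apply: le_trans (ler_normD _ _) _; apply: le_trans (lerD IHk HAt) _.
rewrite powRM ?(ltW t0)// -/rho -mulrDl; apply: ler_wpM2r => //.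
rewrite [leLHS](_ : _ = (A' * rho + A) * t `^ (n%:R * lam)); last by ring.
apply: ler_wpM2r; first exact: powR_ge0.
rewrite le_eqVlt; apply/orP; left; apply/eqP; rewrite /A'; field.
by rewrite subr_eq0 gt_eqF.
Qed.

(** Passing through the average over [B x0 t] leaves the oscillation of [b] on its own ball and a
    constant controlled by [average_far]. Both scale as the volume of [B x0 t] to the power [q^-1]
    times [t ^ (n lam)]. *)
Lemma Lnorm_on_oscillation : exists2 A : R, 0 < A & forall (x0 : Rn) b s t,
  campanato x0 q lam b -> 0 < s -> s <= t ->
  (Lnorm_on q (B x0 t) (fun y => b y - average (B x0 s) b)%R <=
   (A * t `^ (n%:R / q + n%:R * lam) * beta x0 b)%:E)%E.
Proof.
have [A A0 HA] := average_far.
set E := q^-1 + lam; have E0 : 0 <= E by rewrite addr_ge0// ltW.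
exists (2 `^ (n%:R * E) + A * 2 `^ (n%:R / q)).
  by rewrite addr_gt0 ?mulr_gt0 ?powR_gt0.
move=> x0 b s t bC s0 st; have t0 : 0 < t by apply: lt_le_trans st.
have [[mb _] _] := bC; have mB := measurable_euclidean_ball x0 t.
have b0 : 0 <= beta x0 b by rewrite fine_ge0 ?campanato_norm_ge0.
set c := average (B x0 s) b; set d := average (B x0 t) b.
have -> : (fun y => b y - c) = (fun y => b y - d) \+ (fun=> d - c).
  by apply/funext => y /=; rewrite addrA subrK.
apply: le_trans (Lnorm_onD (ltW q_gt1) mB _ _) _ => //.
  by apply: measurable_funB.
apply: le_trans (leeD (Lnorm_on_campanato n_gt0 q_gt0 bC t0) (lexx _)) _.
rewrite Lnorm_on_cst// volE ?(ltW t0)// poweR_EFin -EFinM -EFinD lee_fin.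
rewrite mulrDl mulrDl; apply: lerD.
  rewrite -mulrDr; apply: ler_wpM2r => //; exact: vol_powR_le.
rewrite distrC; apply: le_trans (ler_wpM2r (powR_ge0 _ _) (HA _ _ _ _ bC s0 st)) _.
rewrite [leRHS](_ : _ = A * t `^ (n%:R * lam) * beta x0 b *
   (2 `^ (n%:R / q) * t `^ (n%:R / q))); last first.
  by rewrite powRD_gt0//; ring.
apply: ler_wpM2l; first by rewrite !mulr_ge0 ?powR_ge0// ltW.
exact: vol_powR_le.
Qed.

End campanato_oscillation.

Section excess.
Context (R : realType) (n : nat) (n_gt0 : (0 < n)%N).
Local Notation Rn := 'rV[R]_n.
Local Notation B x0 r := (euclidean_ball x0 r).
Local Notation vol x0 r := (fine (lebesgue_rV (euclidean_ball x0 r))).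
Variables (q lam : R) (q_gt1 : 1 < q) (lam_gt0 : 0 < lam).
Implicit Types (b f : Rn -> R) (r s t : R).

(* Dominates [|b x - b_{B(x0,r)}| + t ^ (n lam) beta], up to the factor
   [t ^ (n lam)], for all [t >= r] at once. *)
Definition excess (x0 : Rn) r b (x : Rn) : R :=
  r `^ (- (n%:R * lam)) * `|b x - average (B x0 r) b| +
  fine (campanato_norm x0 q lam b).

Let q_gt0 : 0 < q. Proof. exact: lt_trans q_gt1. Qed.
Let qV_ge0 : 0 <= q^-1. Proof. by rewrite invr_ge0 ltW. Qed.
Let n0 : 0 < n%:R :> R. Proof. by rewrite ltr0n. Qed.

Lemma excess_ge0 (x0 : Rn) r b x : 0 <= excess x0 r b x.
Proof. by rewrite addr_ge0 ?fine_ge0 ?campanato_norm_ge0// mulr_ge0// powR_ge0. Qed.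

Lemma measurable_excess (x0 : Rn) r b : measurable_fun setT b ->
  measurable_fun setT (excess x0 r b).
Proof.
move=> mb; apply: measurable_funD => //; apply: measurable_funM => //.
by apply: measurableT_comp => //; exact: measurable_funB.
Qed.

(** The weight [r ^ (- n lam)] cancels the [r ^ (n lam)] of the Campanato bound, so that both terms
    of [excess] scale as [r ^ (n / q)]. *)
Lemma Lnorm_on_excess : exists2 A : R, 0 < A & forall (x0 : Rn) b r,
  campanato x0 q lam b -> 0 < r ->
  (Lnorm_on q (B x0 r) (excess x0 r b) <=
    (A * r `^ (n%:R / q) * fine (campanato_norm x0 q lam b))%:E)%E.
Proof.
set E := q^-1 + lam; have E0 : 0 <= E by rewrite addr_ge0// ltW.
exists (2 `^ (n%:R * E) + 2 `^ (n%:R / q)).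
  by rewrite addr_gt0 ?powR_gt0.
move=> x0 b r bC r0; have [[mb _] _] := bC.
have mB := measurable_euclidean_ball x0 r.
have b0 : 0 <= fine (campanato_norm x0 q lam b) by rewrite fine_ge0 ?campanato_norm_ge0.
have mc : measurable_fun setT (fun x => b x - average (B x0 r) b).
  exact: measurable_funB.
apply: le_trans (Lnorm_onD (ltW q_gt1) mB _ _) _ => //.
  by apply: measurable_funM => //; exact: measurableT_comp.
rewrite Lnorm_on_cst// volE ?(ltW r0)// poweR_EFin -EFinM.
set c := r `^ (- (n%:R * lam)); have c0 : 0 <= c by exact: powR_ge0.
have -> : Lnorm_on q (B x0 r) (fun x => c * `|b x - average (B x0 r) b|) =
    (c%:E * Lnorm_on q (B x0 r) (fun x => b x - average (B x0 r) b)%R)%E.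
  rewrite /Lnorm_on -LnormZ_EFin//; last exact: measurable_patch.
  rewrite -[RHS]Lnorm_abse; congr Lnorm; apply/funext => x /=; congr EFin.
  rewrite normrM !patchE (ger0_norm c0); case: ifPn => // _.
  by rewrite normr0 mulr0.
apply: le_trans (leeD (lee_wpmul2l _ (Lnorm_on_campanato n_gt0 q_gt0 bC r0)) (lexx _)) _.
  by rewrite lee_fin.
rewrite -EFinM -EFinD lee_fin ger0_norm// 2!mulrDl; apply: lerD; last first.
  by rewrite mulrC; apply: ler_wpM2r => //; exact: vol_powR_le.
rewrite mulrA; apply: ler_wpM2r => //.
apply: le_trans (ler_wpM2l c0 (vol_powR_le n_gt0 x0 E0 r0)) _.
rewrite mulrCA /c -powRD_gt0//; apply: ler_wpM2l; first exact: powR_ge0.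
by rewrite /E mulrDr addrC addrK.
Qed.

(** Hoelder's inequality with three factors: the indicator of the ball, [b x - b z] in L^q and [f]
    in L^p. The indicator has the inverse exponent [e0], and [n * e0 + n / q = n - n / p] gives the
    power of [t]. The average over [B x0 r] is inserted between [b x] and [b z]. *)
Lemma integral_commutator_ball (p : R) : 1 < p -> p^-1 + q^-1 < 1 ->
  exists2 A : R, 0 < A & forall (x0 x : Rn) b f r t,
  campanato x0 q lam b -> measurable_fun setT f -> 0 < r -> r <= t ->
  (\int[lebesgue_rV]_(z in B x0 t) `|(b x - b z) * f z|%:E <=
   (A * t `^ (n%:R - n%:R / p + n%:R * lam) * excess x0 r b x)%:E *
   Lnorm_on p (B x0 t) f)%E.
Proof.
move=> p1 pq1; have p0 : 0 < p by apply: lt_trans p1.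
have [A A0 HA] := Lnorm_on_oscillation n_gt0 q_gt1 lam_gt0.
set e0 : R := 1 - p^-1 - q^-1; have e00 : 0 < e0 by rewrite /e0; lra.
(* [A] serves the oscillation of [b] in [z], and [2 ^ (n / q)] serves the norm over [B x0 t] of the
   part that is constant in [z]. *)
set M := Num.max A (2 `^ (n%:R / q)).
have AM : A <= M by rewrite le_max lexx.
have M0 : 0 < M by apply: lt_le_trans AM.
exists (2 `^ (n%:R * e0) * M); first by rewrite mulr_gt0 ?powR_gt0.
move=> x0 x b f r t bC mf r0 rt; have t0 : 0 < t by apply: lt_le_trans rt.
have [[mb _] _] := bC; have mB := measurable_euclidean_ball x0 t.
have b0 : 0 <= fine (campanato_norm x0 q lam b) by rewrite fine_ge0 ?campanato_norm_ge0.
have mbx : measurable_fun setT (fun z => b x - b z) by apply: measurable_funB.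
have e0V : 0 < e0^-1 by rewrite invr_gt0.
apply: le_trans (hoelder_on2 mB mbx mf e0V q_gt0 p0 _) _.
  by rewrite invrK /e0; lra.
rewrite muleA; apply: lee_wpmul2r; first exact: Lnorm_on_ge0.
rewrite invrK volE ?(ltW t0)// poweR_EFin.
set c := average (B x0 r) b.
have NE : Lnorm_on q (B x0 t) (fun z => b x - b z) =
    Lnorm_on q (B x0 t) ((fun z => b z - c) \+ (fun=> c - b x)).
  rewrite /Lnorm_on -[LHS]Lnorm_abse -[RHS]Lnorm_abse; congr Lnorm.
  apply/funext => z /=; congr EFin; rewrite !patchE; case: ifPn => // _ /=.
  by rewrite distrC addrA subrK.
have H : (Lnorm_on q (B x0 t) (fun z => b x - b z)%R <=
    (M * t `^ (n%:R / q + n%:R * lam) * excess x0 r b x)%:E)%E.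
  rewrite NE; apply: le_trans (Lnorm_onD (ltW q_gt1) mB _ _) _ => //.
    exact: measurable_funB.
  apply: le_trans (leeD (HA _ _ _ _ bC r0 rt) (lexx _)) _.
  rewrite Lnorm_on_cst// volE ?(ltW t0)// poweR_EFin -EFinM -EFinD lee_fin.
  rewrite addrC /excess -/c mulrDr; apply: lerD; last first.
    by rewrite -!mulrA; apply: ler_wpM2r => //; rewrite mulr_ge0 ?powR_ge0.
  rewrite distrC mulrA mulrC; apply: ler_wpM2r => //.
  apply: le_trans (vol_powR_le n_gt0 x0 qV_ge0 t0) _.
  rewrite -mulrA; apply: ler_pM; rewrite ?powR_ge0//; first by rewrite le_max lexx orbT.
  (* The constant part has no factor [t ^ (n lam)] of its own; since [r <= t], the factor
     [t ^ (n lam) * r ^ (- n lam)], which is at least 1, may be inserted. *)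
  rewrite powRD_gt0// -mulrA -[leLHS]mulr1; apply: ler_wpM2l; first exact: powR_ge0.
  rewrite powRN ler_pdivlMr ?powR_gt0// mul1r.
  apply: ge0_ler_powR; rewrite ?nnegrE//.
  - by rewrite mulr_ge0 ?ltW.
  - exact: ltW.
  - exact: ltW.
apply: le_trans (lee_wpmul2l _ H) _; first by rewrite lee_fin powR_ge0.
rewrite -EFinM lee_fin mulrA; apply: ler_wpM2r; first exact: excess_ge0.
rewrite [leRHS](_ : _ = 2 `^ (n%:R * e0) * t `^ (n%:R * e0) *
    (M * t `^ (n%:R / q + n%:R * lam))); last first.
  rewrite mulrACA -[in RHS]powRD_gt0//; congr (_ * _ `^ _).
  by rewrite /e0 !mulrBr; ring.
apply: ler_wpM2r; first by rewrite mulr_ge0 ?powR_ge0// ltW.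
by apply: vol_powR_le => //; exact: ltW.
Qed.

End excess.

(** * The tails *)

(** One dyadic interval, of length [D], suffices for both lower bounds of integrals over radii: [D]
    will be the largest |y_j - x0| in the tail estimate and [2 * r] in the local one. *)
Lemma le_integral_of_bump (R : realType) (h : R -> \bar R) (c D : R) :
  (forall t, 0 <= h t)%E -> 0 <= c -> 0 < D ->
  (forall t, D < t < 2 * D -> (c%:E <= h t)%E) ->
  ((c * D)%:E <= \int[lebesgue_measure]_t h t)%E.
Proof.
move=> h0 c0 D0 ch.
have -> : (c * D)%:E = (\int[lebesgue_measure]_(t in `]D, (2 * D)%R[%classic) c%:E)%E.
  rewrite integral_cst// EFinM; congr (_ * _)%E; apply/esym.
  apply: eq_trans (lebesgue_measure_itv _) _; rewrite /= lte_fin ifT; last by lra.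
  by rewrite -EFinB; congr EFin; ring.
rewrite integral_mkcond; apply: ge0_le_integral_nomeas => t _; rewrite patchE.
  by case: ifPn => // _; rewrite lee_fin.
case: ifPn => [|_]; last exact: h0.
by rewrite inE /= in_itv /= => /ch.
Qed.

Section tail.
Context (R : realType) (m n : nat) (n_gt0 : (0 < n)%N).
Local Notation Rn := 'rV[R]_n.
Local Notation B x0 r := (euclidean_ball x0 r).
Local Notation dist x y := (euclidean_norm (x - y)).
Variable K : m.+1.-tuple Rn -> R.
Hypothesis kerK : cz_kernel K.

Let ball_part (x0 : Rn) (g : 'I_m -> Rn -> R) (i : 'I_m) (t : R) (z : Rn) : R :=
  if dist z x0 < t then `|g i z| else 0.

Let ball_part_ge0 (x0 : Rn) g i t z : 0 <= ball_part x0 g i t z.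
Proof. by rewrite /ball_part; case: ifP. Qed.

(** The layers of the kernel bound. Integration over the radius dominates the product of a multiple
    of max_j |y_j - x0|^(-mn) and the |g_i(y_i)|, provided that this maximum is at least 2r. For a
    fixed radius each layer is a product of functions of the single y_i, which the kernel bound is
    not. *)
Let shell (x0 : Rn) (C r : R) g (yt : m.-tuple Rn * R) : R :=
  if 2 * r < yt.2 then C * yt.2 `^ (- (m * n).+1%:R) *
    \prod_(i < m) ball_part x0 g i yt.2 (tnth yt.1 i) else 0.

Let shell_ge0 (x0 : Rn) (C r : R) g yt : 0 <= C -> 0 <= shell x0 C r g yt.
Proof.
move=> C0; rewrite /shell; case: ifP => // _.
by rewrite !mulr_ge0 ?powR_ge0// prodr_ge0.
Qed.

Lemma measurable_cz_commutator_integrand b f (x : Rn) :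
  (forall i, measurable_fun setT (b i)) -> (forall i, measurable_fun setT (f i)) ->
  measurable_fun setT (cz_commutator_integrand K b f x).
Proof.
move=> mb mf; apply: measurable_funM; first exact: measurable_cz_kernel.
apply: measurable_prod => i _.
have mt := @measurable_tnth _ Rn m i.
apply: measurable_funM; last exact: (measurableT_comp (mf i) mt).
by apply: measurable_funB => //; exact: (measurableT_comp (mb i) mt).
Qed.

Lemma measurable_split_fun (x0 : Rn) r alpha (f : 'I_m -> Rn -> R) i :
  measurable_fun setT (f i) -> measurable_fun setT (split_fun x0 r alpha f i).
Proof.
move=> mf; have mB := measurable_euclidean_ball x0 (2 * r).
by rewrite /split_fun; case: ifP => _; apply: measurable_patch => //; exact: measurableC.
Qed.

Lemma cz_commutator_integrand_le_shell : exists2 C : R, 0 < C &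
  forall (x0 x : Rn) r b f (alpha : {set 'I_m}) (y : m.-tuple Rn),
    B x0 r x -> 0 < r -> alpha != finset.set0 ->
    (`|cz_commutator_integrand K b (split_fun x0 r alpha f) x y|%:E <=
     \int[lebesgue_measure]_t
       (shell x0 C r (fun i z => (b i x - b i z) * f i z) (y, t))%:E)%E.
Proof.
have [C C0 HC] := cz_kernel_le kerK.
(* For [t] between [D] and [2 * D] the power [t ^ (-(mn + 1))] is at least [(2 * D) ^ (-(mn + 1))].
   Times the length [D] this is [D ^ (-mn) / 2 ^ (mn + 1)]. *)
exists (C * 2 ^+ (m * n).+1); first by rewrite mulr_gt0// exprn_gt0.
move=> x0 x r b f alpha y xr r0 /finset.set0Pn[i0 i0a].
set g := (fun (i : 'I_m) (z : Rn) => (b i x - b i z) * f i z).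
set C1 := C * _; have C10 : 0 < C1 by rewrite mulr_gt0// exprn_gt0.
have int0 : (0 <= \int[lebesgue_measure]_t (shell x0 C1 r g (y, t))%:E)%E.
  by apply: integral_ge0 => t _; rewrite lee_fin shell_ge0// ltW.
have [y0|y0] := ltP (dist (tnth y i0) x0) (2 * r).
  (* The function with index [i0] is cut off inside the doubled ball, so the integrand vanishes. *)
  rewrite /cz_commutator_integrand (bigD1 i0)//= /split_fun i0a patchE memNset.
    by rewrite mulr0 mul0r mulr0 normr0.
  by apply; rewrite /euclidean_ball /=.
(* With the farthest component as [D], every radius [t > D] has all [y_i] in its ball, so that no
   factor of [shell] is cut off. *)
pose j := [arg max_(i > i0) dist (tnth y i) x0]%O.
have jmax i : dist (tnth y i) x0 <= dist (tnth y j) x0.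
  by rewrite /j; case: arg_maxP => // k _; exact.
set D := dist (tnth y j) x0 in jmax.
have rD : 2 * r <= D by apply: le_trans y0 (jmax i0).
have D0 : 0 < D by lra.
set P := \prod_(i < m) `|g i (tnth y i)|.
have P0 : 0 <= P by rewrite prodr_ge0.
have le1 : `|cz_commutator_integrand K b (split_fun x0 r alpha f) x y| <= C / D ^+ (m * n) * P.
  rewrite /cz_commutator_integrand normrM normr_prod; apply: ler_pM => //.
  - by rewrite prodr_ge0.
  - by apply: (HC x0 x r y j).
  (* The cutoffs only decrease the absolute values. Dropping them makes the bound the same for all
     [alpha]. *)
  apply: ler_prod => i _; rewrite normr_ge0/= /g !normrM ler_wpM2l// /split_fun.
  by case: ifP => _; rewrite patchE; case: ifP => // _; rewrite normr0.
pose c := C1 * (2 * D) `^ (- (m * n).+1%:R) * P.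
apply: (@le_trans _ _ (c * D)%:E); rewrite ?/c.
  rewrite lee_fin; apply: le_trans le1 _; rewrite le_eqVlt; apply/orP; left; apply/eqP.
  rewrite powR_invn ?mulr_ge0 ?(ltW D0)// exprMn /C1 [D ^+ (m * n).+1]exprSr.
  have : 2 ^+ (m * n).+1 != 0 :> R by rewrite gt_eqF// exprn_gt0.
  have : D ^+ (m * n) != 0 by rewrite gt_eqF// exprn_gt0.
  move: (D ^+ (m * n)) (2 ^+ (m * n).+1) => u v u0 v0.
  by field; rewrite u0 v0 gt_eqF.
apply: le_integral_of_bump => //.
- by move=> t; rewrite lee_fin shell_ge0// ltW.
- by rewrite !mulr_ge0 ?powR_ge0// ltW.
move=> t /andP[Dt tD]; rewrite lee_fin /shell /= ifT; last exact: le_lt_trans Dt.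
have -> : \prod_(i < m) ball_part x0 g i t (tnth y i) = P.
  by apply: eq_bigr => i _; rewrite /ball_part ifT//; exact: le_lt_trans (jmax i) Dt.
apply: ler_wpM2r => //; apply: ler_wpM2l; first exact: ltW.
have t0 : 0 < t by lra.
rewrite !powRN lef_pV2 ?posrE ?powR_gt0//; last by lra.
by apply: ge0_ler_powR => //; rewrite ?nnegrE; lra.
Qed.

Let measurable_ball_part (x0 : Rn) g i : measurable_fun setT (g i) ->
  measurable_fun setT (fun zt : Rn * R => ball_part x0 g i zt.2 zt.1).
Proof.
move=> mg; apply: measurable_fun_ifT => //=.
  apply: measurable_fun_ltr => //.
  exact: (measurableT_comp (measurable_euclidean_dist x0) measurable_fst).
by apply: measurableT_comp => //; exact: (measurableT_comp mg measurable_fst).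
Qed.

Let measurable_shell (x0 : Rn) (C r : R) g : (forall i, measurable_fun setT (g i)) ->
  measurable_fun setT (shell x0 C r g).
Proof.
move=> mg; apply: measurable_fun_ifT => //=; first exact: measurable_fun_ltr.
apply: measurable_funM.
  apply: measurable_funM => //.
  exact: (measurableT_comp (measurable_powR _) measurable_snd).
apply: measurable_prod => i _.
pose pr (yt : m.-tuple Rn * R) : Rn * R := (tnth yt.1 i, yt.2).
have mpr : measurable_fun setT pr.
  apply/measurable_fun_pairP; split; last exact: measurable_snd.
  exact: (measurableT_comp (@measurable_tnth _ Rn m i) measurable_fst).
exact: (measurableT_comp (measurable_ball_part x0 (mg i)) mpr).
Qed.

Let integral_ball_part (x0 : Rn) g i t :
  (\int[lebesgue_rV]_z (ball_part x0 g i t z)%:E =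
   \int[lebesgue_rV]_(z in B x0 t) `|g i z|%:E)%E.
Proof.
rewrite [RHS]integral_mkcond; apply: eq_integral => z _; rewrite patchE /ball_part.
by rewrite /euclidean_ball; case: ifPn => zt; [rewrite mem_set|rewrite memNset//=; exact/negP].
Qed.

(** By Tonelli's theorem, applied to the function of [(t, z)] that is [|f z| ^ p] for |z - x0| < t
    and zero otherwise. It makes the integrand of the claimed bound measurable, so that constants
    may be moved into the integral. *)
Lemma measurable_Lnorm_on_ball (p : R) (x0 : Rn) (f : Rn -> R) : 0 < p ->
  measurable_fun setT f ->
  measurable_fun setT (fun t => Lnorm_on p (B x0 t) f).
Proof.
move=> p0 mf; under eq_fun do rewrite Lnorm_onE ?gt_eqF//.
apply: (measurableT_comp (@measurable_poweR R _)).
pose h (tz : R * Rn) := (if dist tz.2 x0 < tz.1 then `|f tz.2| `^ p else 0)%:E.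
have mh : measurable_fun setT h.
  apply/measurable_EFinP; apply: measurable_fun_ifT => //=.
    apply: measurable_fun_ltr => //.
    exact: (measurableT_comp (measurable_euclidean_dist x0) measurable_snd).
  apply: (measurableT_comp (measurable_powR _)).
  by apply: measurableT_comp => //; exact: (measurableT_comp mf measurable_snd).
have h0 tz : (0 <= h tz)%E by rewrite lee_fin; case: ifP => // _; exact: powR_ge0.
have := @measurable_fun_fubini_tonelli_F _ _ R Rn R lebesgue_rV h mh h0.
apply: eq_measurable_fun => t _; rewrite /fubini_F [RHS]integral_mkcond.
apply: eq_integral => z _; rewrite patchE /h /=.
by rewrite /euclidean_ball; case: ifPn => zt; [rewrite mem_set|rewrite memNset//=; exact/negP].
Qed.

Lemma integral_shell (x0 : Rn) (C r : R) g : 0 <= C -> (forall i, measurable_fun setT (g i)) ->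
  (\int[tuple_measure lebesgue_rV m]_y \int[lebesgue_measure]_t (shell x0 C r g (y, t))%:E =
   \int[lebesgue_measure]_(t in `](2 * r)%R, +oo[%classic)
     ((C * t `^ (- (m * n).+1%:R))%:E *
      \prod_(i < m) \int[lebesgue_rV]_(z in B x0 t) `|g i z|%:E))%E.
Proof.
move=> C0 mg.
have mshell : measurable_fun setT (EFin \o shell x0 C r g).
  by apply/measurable_EFinP; exact: measurable_shell.
have shellE0 yt : (0 <= (EFin \o shell x0 C r g) yt)%E by rewrite lee_fin shell_ge0.
have /= -> := @fubini_tonelli _ _ _ _ R (tuple_measure lebesgue_rV m) lebesgue_measure
  (EFin \o shell x0 C r g) mshell shellE0.
rewrite [RHS]integral_mkcond; apply: eq_integral => t _; rewrite patchE.
have [rt|tr] := ltP (2 * r) t; last first.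
  rewrite memNset; last by rewrite /= in_itv/= andbT; apply/negP; rewrite -leNgt.
  by apply: integral0_eq => y _; rewrite /shell /= ltNge tr.
rewrite mem_set; last by rewrite /= in_itv/= rt.
have mball i : measurable_fun setT (fun z => (ball_part x0 g i t z)%:E).
  apply/measurable_EFinP; apply: measurable_fun_ifT => //=.
    by apply: measurable_fun_ltr => //; exact: measurable_euclidean_dist.
  by apply: measurableT_comp.
under [in RHS]eq_bigr do rewrite -integral_ball_part.
rewrite -ge0_integral_tuple_prod//; last by move=> i z; rewrite lee_fin.
rewrite -ge0_integralZl_EFin//; first last.
- by rewrite mulr_ge0 ?powR_ge0.
- apply: emeasurable_prod => i.
  exact: (measurableT_comp (mball i) (@measurable_tnth _ Rn m i)).
- by move=> y _; apply: prode_ge0 => i _; rewrite lee_fin.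
by apply: eq_integral => y _; rewrite /shell /= rt EFinM prodEFin.
Qed.

Variables (p q lam : 'I_m -> R).
Hypotheses (p_gt1 : forall i, 1 < p i) (q_gt1 : forall i, 1 < q i)
  (lam_gt0 : forall i, 0 < lam i) (pq_lt1 : forall i, (p i)^-1 + (q i)^-1 < 1).

Lemma tail_integral_le : exists2 C : R, 0 < C &
  forall (x0 x : Rn) r b f (alpha : {set 'I_m}),
    (forall i, campanato x0 (q i) (lam i) (b i)) -> (forall i, measurable_fun setT (f i)) ->
    B x0 r x -> 0 < r -> alpha != finset.set0 ->
    (\int[tuple_measure lebesgue_rV m]_y
       `|cz_commutator_integrand K b (split_fun x0 r alpha f) x y|%:E <=
     (C * \prod_(i < m) excess (q i) (lam i) x0 r (b i) x)%:E *
     \int[lebesgue_measure]_(t in `](2 * r)%R, +oo[)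
    (((1 + ln (t / r)) ^+ m *
      t `^ (n%:R * \sum_(i < m) lam i -
            n%:R * \sum_(i < m) (p i)^-1 - 1))%:E *
     \prod_(i < m) Lnorm_on (p i) (euclidean_ball x0 t) (f i)))%E.
Proof.
have [C C0 HC] := cz_commutator_integrand_le_shell.
have /choice[A HA] i : exists A : R, 0 < A /\ forall (x0 x : Rn) b f r t,
  campanato x0 (q i) (lam i) b -> measurable_fun setT f -> 0 < r -> r <= t ->
  (\int[lebesgue_rV]_(z in B x0 t) `|(b x - b z) * f z|%:E <=
   (A * t `^ (n%:R - n%:R / p i + n%:R * lam i) * excess (q i) (lam i) x0 r b x)%:E *
   Lnorm_on (p i) (B x0 t) f)%E.
  have [A A0 H] := integral_commutator_ball n_gt0 (q_gt1 i) (lam_gt0 i) (p_gt1 i) (pq_lt1 i).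
  by exists A.
have PA0 : 0 < \prod_i A i by apply: prodr_gt0 => i _; exact: (HA i).1.
exists (C * \prod_i A i); first by rewrite mulr_gt0.
move=> x0 x r b f alpha bC mf xr r0 a0.
have mb i : measurable_fun setT (b i) by have [[]] := bC i.
set H := fun t : R => (((1 + ln (t / r)) ^+ m * _)%:E * _)%E.
have L0 t : (0 <= \prod_(i < m) Lnorm_on (p i) (B x0 t) (f i))%E.
  by apply: prode_ge0 => i _; exact: Lnorm_on_ge0.
have PG0 : 0 <= \prod_(i < m) excess (q i) (lam i) x0 r (b i) x.
  by apply: prodr_ge0 => i _; exact: excess_ge0.
rewrite -ge0_integralZl_EFin//; last 3 first.
- move=> t /=; rewrite in_itv/= andbT => rt; apply: mule_ge0 => //.
  rewrite lee_fin mulr_ge0 ?powR_ge0// exprn_ge0// addr_ge0// ln_ge0//.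
  by rewrite ler_pdivlMr// mul1r; lra.
- apply: measurable_funTS; apply: emeasurable_funM.
    apply/measurable_EFinP; apply: measurable_funM => //.
    apply: measurable_funX; apply: measurable_funD => //.
    by apply: (measurableT_comp (@measurable_ln R)); exact: measurable_funM.
  apply: emeasurable_prod => i; apply: measurable_Lnorm_on_ball => //.
  exact: lt_trans (p_gt1 i).
- by rewrite mulr_ge0// ltW// mulr_gt0.
pose g (i : 'I_m) (z : Rn) := (b i x - b i z) * f i z.
have mg i : measurable_fun setT (g i).
  by apply: measurable_funM => //; exact: measurable_funB.
apply: (@le_trans _ _ (\int[tuple_measure lebesgue_rV m]_y
    \int[lebesgue_measure]_t (shell x0 C r g (y, t))%:E)%E).
  by apply: ge0_le_integral_nomeas => y _; [rewrite lee_fin|exact: HC].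
rewrite integral_shell//; last exact: ltW.
apply: ge0_le_integral_nomeas => t /=; rewrite in_itv/= andbT => rt.
  rewrite mule_ge0// ?lee_fin ?mulr_ge0 ?powR_ge0 ?(ltW C0)//.
  by apply: prode_ge0 => i _; exact: integral_ge0.
have t0 : 0 < t by lra.
have leP : (\prod_(i < m) \int[lebesgue_rV]_(z in B x0 t) `|g i z|%:E <=
    (\prod_(i < m) (A i * t `^ (n%:R - n%:R / p i + n%:R * lam i) *
      excess (q i) (lam i) x0 r (b i) x))%:E *
     \prod_(i < m) Lnorm_on (p i) (B x0 t) (f i))%E.
  rewrite -prodEFin -big_split/=; apply: lee_prod => i _.
  rewrite integral_ge0//=; apply: (HA i).2 => //; lra.
apply: le_trans (lee_wpmul2l _ leP) _.
  by rewrite lee_fin mulr_ge0 ?powR_ge0 ?(ltW C0).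
rewrite muleA /H muleA -!EFinM; apply: lee_wpmul2r => //; rewrite lee_fin.
rewrite !big_split/=.
rewrite powR_prod//.
set e := \sum_(i < m) _; set PA := \prod_(i < m) A i; set PG := \prod_(i < m) _.
(* Each factor contributes [n - n / p_i + n lam_i]. The [m] copies of [n] cancel against the power
   of the kernel, and only the -1 of [-(mn + 1)] remains. *)
have -> : n%:R * (\sum_(i < m) lam i) - n%:R * (\sum_(i < m) (p i)^-1) - 1 =
    - (m * n).+1%:R + e.
  rewrite /e big_split/= sumrB sumr_const card_ord !mulr_sumr -[n%:R *+ m]mulr_natr -natrM mulnC.
  by rewrite -natr1; ring.
rewrite powRD_gt0// [leLHS](_ : _ = C * PA * PG * (1 * (t `^ (- (m * n).+1%:R) * t `^ e)));
  last by ring.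
apply: ler_wpM2l; first by rewrite mulr_ge0// ltW// mulr_gt0.
apply: ler_wpM2r; first by rewrite mulr_ge0 ?powR_ge0.
rewrite exprn_ege1// lerDl ln_ge0// ler_pdivlMr// mul1r; lra.
Qed.

End tail.

(** * The local part *)

Section commutator_shift.
Context (R : realType) (m n : nat).
Local Notation Rn := 'rV[R]_n.
Variables (T : ('I_m -> Rn -> R) -> Rn -> R) (u : 'I_m -> R).

Hypothesis T_linear : forall f i (a : R) g h,
  (forall j, f j \in Lfun lebesgue_rV (u j)%:E) ->
  g \in Lfun lebesgue_rV (u i)%:E -> h \in Lfun lebesgue_rV (u i)%:E ->
  {ae lebesgue_rV, forall x, T (replace_fun f i (a \*o g \+ h)) x =
    a * T (replace_fun f i g) x + T (replace_fun f i h) x}.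

Lemma ae_eq_sum (I : Type) (l : seq I) (P : pred I) (F G : I -> Rn -> R) :
  (forall s, P s -> {ae lebesgue_rV, forall x, F s x = G s x}) ->
  {ae lebesgue_rV, forall x : Rn, \sum_(s <- l | P s) F s x = \sum_(s <- l | P s) G s x}.
Proof.
move=> FG; elim: l => [|s l IH]; first by apply: aeW => x; rewrite !big_nil.
case: (boolP (P s)) => Ps; last first.
  by apply: filterS IH => x; rewrite !big_cons (negbTE Ps).
by apply: filterS2 IH (FG s Ps) => x IHx E; rewrite !big_cons Ps IHx E.
Qed.

Let term b f (s : {set 'I_m}) (x : Rn) : R :=
  (-1) ^+ #|s| * (\prod_(i in ~: s) b i x) *
    T (fun i => if i \in s then b i \* f i else f i) x.

Let sum_set_pair (F : {set 'I_m} -> R) i :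
  \sum_(s : {set 'I_m}) F s = \sum_(s : {set 'I_m} | i \notin s) (F s + F (i |: s)%SET).
Proof.
rewrite (bigID (fun s : {set 'I_m} => i \notin s))/= big_split/=; congr (_ + _).
rewrite (reindex_onto (fun s : {set 'I_m} => i |: s)%SET (fun s => s :\ i)%SET)/=; last first.
  by move=> s /negPn /finset.setD1K.
apply: eq_bigl => s; rewrite negbK finset.setU11/=.
apply/eqP/idP => [<-|/finset.setU1K//]; by rewrite finset.setD11.
Qed.

(* The terms of [s] and [i |: s] recombine, by linearity in the i-th slot. *)
Lemma cz_commutator_cs_shift1 b f i (c : R) :
  (forall j, f j \in Lfun lebesgue_rV (u j)%:E) ->
  (forall j, (b j \* f j)%R \in Lfun lebesgue_rV (u j)%:E) ->
  {ae lebesgue_rV, forall x, cz_commutator_cs T b f x =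
    cz_commutator_cs T (fun j y => if j == i then b j y - c else b j y) f x}.
Proof.
move=> Lf Lbf; set b' := fun (j : 'I_m) (y : Rn) => if j == i then b j y - c else b j y.
rewrite /cz_commutator_cs.
suff : {ae lebesgue_rV, forall x, \sum_(s : {set 'I_m} | i \notin s)
      (term b f s x + term b f (i |: s)%SET x) =
    \sum_(s : {set 'I_m} | i \notin s) (term b' f s x + term b' f (i |: s)%SET x)}.
  by apply: filterS => x; rewrite -!sum_set_pair.
apply: ae_eq_sum => s si.
pose h0 j := if j \in s then b j \* f j else f j.
have Lh0 j : h0 j \in Lfun lebesgue_rV (u j)%:E by rewrite /h0; case: ifP.
have := T_linear (- c) Lh0 (Lf i) (Lbf i); apply: filterS => x Tx.
have E0 : (fun j => if j \in s then b' j \* f j else f j) = h0.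
  apply/funext => j; rewrite /h0; case: ifPn => // js; apply/funext => y /=.
  by rewrite /b'; case: eqP => // ji; move: si; rewrite -ji js.
have Eh0 : replace_fun h0 i (f i) = h0.
  by apply/funext => j; rewrite /replace_fun /h0; case: eqP => // ->; rewrite (negbTE si).
have E1 : (fun j => if j \in (i |: s)%SET then b j \* f j else f j) =
    replace_fun h0 i (b i \* f i).
  apply/funext => j; rewrite /replace_fun in_setU1 /h0.
  by case: eqP => [->|].
have E2 : (fun j => if j \in (i |: s)%SET then b' j \* f j else f j) =
    replace_fun h0 i (- c \*o f i \+ b i \* f i).
  apply/funext => j; rewrite /replace_fun in_setU1 /h0 /b'.
  have [->|ji]/= := eqVneq j i; first by apply/funext => y /=; ring.
  by case: ifP.
have Pb (b0 : 'I_m -> Rn -> R) : \prod_(j in ~: s) b0 j x =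
    b0 i x * \prod_(j in ~: (i |: s)%SET) b0 j x.
  rewrite (bigD1 i)/=; last by rewrite finset.in_setC.
  by congr (_ * _); apply: eq_bigl => j; rewrite !finset.in_setC in_setU1 negb_or andbC.
have Pb' : \prod_(j in ~: (i |: s)%SET) b' j x = \prod_(j in ~: (i |: s)%SET) b j x.
  apply: eq_bigr => j; rewrite finset.in_setC in_setU1 negb_or => /andP[ji _].
  by rewrite /b' (negbTE ji).
rewrite /term E0 E1 E2 -/h0 Tx Eh0 !Pb Pb' /b' eqxx cardsU1 si exprS /=; ring.
Qed.

(** The indices are shifted one after the other. Requiring the second hypothesis for every constant
    [a] keeps the partially shifted functions admissible: [a] is [c j] for an index already treated
    and 0 for the others. *)
Lemma cz_commutator_cs_shift b f (c : 'I_m -> R) :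
  (forall j, f j \in Lfun lebesgue_rV (u j)%:E) ->
  (forall j a, ((fun y => b j y - a) \* f j)%R \in Lfun lebesgue_rV (u j)%:E) ->
  {ae lebesgue_rV, forall x, cz_commutator_cs T b f x =
    cz_commutator_cs T (fun j y => b j y - c j) f x}.
Proof.
move=> Lf Lbf.
suff H (l : seq 'I_m) : uniq l -> {ae lebesgue_rV, forall x, cz_commutator_cs T b f x =
    cz_commutator_cs T (fun j y => if j \in l then b j y - c j else b j y) f x}.
  apply: filterS (H _ (enum_uniq 'I_m)) => x ->; congr (cz_commutator_cs T _ f x).
  by apply/funext => j; apply/funext => y; rewrite mem_enum.
elim: l => [_|i l IH /= /andP[il /IH {}IH]]; first by apply: aeW.
set bl := fun (j : 'I_m) (y : Rn) => if j \in l then b j y - c j else b j y.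
have Lbl j : (bl j \* f j)%R \in Lfun lebesgue_rV (u j)%:E.
  have [jl|jl] := boolP (j \in l).
    by rewrite (_ : _ \* _ = (fun y => b j y - c j) \* f j)//; apply/funext => y /=; rewrite /bl jl.
  rewrite (_ : _ \* _ = (fun y => b j y - 0) \* f j)//.
  by apply/funext => y /=; rewrite /bl (negbTE jl) subr0.
apply: filterS2 IH (cz_commutator_cs_shift1 i (c i) Lf Lbl) => x -> ->.
congr (cz_commutator_cs T _ f x); apply/funext => j; apply/funext => y.
rewrite in_cons /bl; have [->|//] := eqVneq j i.
by rewrite (negbTE il).
Qed.

End commutator_shift.

Section local_part.
Context (R : realType) (m n : nat) (n_gt0 : (0 < n)%N).
Local Notation Rn := 'rV[R]_n.
Local Notation B x0 r := (euclidean_ball x0 r).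
Variables (T : ('I_m -> Rn -> R) -> Rn -> R).
Variables (pp : R) (p q lam : 'I_m -> R).
Hypotheses (pp_gt1 : 1 < pp) (p_gt1 : forall i, 1 < p i) (q_gt1 : forall i, 1 < q i)
  (lam_gt0 : forall i, 0 < lam i)
  (ppE : pp^-1 = \sum_(i < m) (p i)^-1 + \sum_(i < m) (q i)^-1).
Hypothesis T_bounded : forall (s_ : 'I_m -> R) (s : R), (forall i, 1 < s_ i) ->
  s^-1 = \sum_(i < m) (s_ i)^-1 ->
  [/\ forall f, (forall i, f i \in Lfun lebesgue_rV (s_ i)%:E) ->
        measurable_fun setT (T f),
    forall f i (a : R) g h, (forall j, f j \in Lfun lebesgue_rV (s_ j)%:E) ->
      g \in Lfun lebesgue_rV (s_ i)%:E -> h \in Lfun lebesgue_rV (s_ i)%:E ->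
      {ae lebesgue_rV, forall x, T (replace_fun f i (a \*o g \+ h)) x =
        a * T (replace_fun f i g) x + T (replace_fun f i h) x} &
    exists2 C : R, 0 < C & forall f,
      (forall i, f i \in Lfun lebesgue_rV (s_ i)%:E) ->
      ('N[lebesgue_rV]_s%:E [EFin \o T f] <=
        C%:E * \prod_(i < m) 'N[lebesgue_rV]_(s_ i)%:E [EFin \o f i])%E].

Let p_gt0 i : 0 < p i. Proof. exact: lt_trans (p_gt1 i). Qed.
Let q_gt0 i : 0 < q i. Proof. exact: lt_trans (q_gt1 i). Qed.
Let pp_gt0 : 0 < pp. Proof. exact: lt_trans pp_gt1. Qed.
(** The exponent that Hoelder's inequality gives to [b_i f_i]. The truncated [f_i] also lies in L^(u
    i), being its product with the constant 1, which has finite L^(q i) norm on the doubled ball; so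
    this one tuple is available for every subset when linearity is used. *)
Let u i := ((p i)^-1 + (q i)^-1)^-1.
Let uV_gt0 i : 0 < (p i)^-1 + (q i)^-1.
Proof. by rewrite addr_gt0// invr_gt0. Qed.

Lemma sum_exponents_lt1 i : (p i)^-1 + (q i)^-1 < 1.
Proof.
apply: (@le_lt_trans _ _ pp^-1); last by rewrite invf_lt1.
rewrite ppE; apply: lerD; rewrite (bigD1 i)//= lerDl; apply: sumr_ge0 => j _;
  by rewrite invr_ge0 ltW.
Qed.

Let u_gt1 i : 1 < u i.
Proof. by rewrite /u -[X in X < _]invr1 ltf_pV2 ?posrE// sum_exponents_lt1. Qed.

(** The exponents for the estimate of the term of [s]. A slot in [s] holds a product [b_i f_i]; a
    slot outside holds [f_i] alone, and its [(q i)^-1] is left for the factor [b_i x] in front of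
    [T]. *)
Let expo (s : {set 'I_m}) i := if i \in s then u i else p i.

Let expo_gt1 s i : 1 < expo s i.
Proof. by rewrite /expo; case: ifP. Qed.

Let sum_expo s :
  pp^-1 = \sum_(i < m) (expo s i)^-1 + \sum_(i in ~: s) (q i)^-1.
Proof.
rewrite ppE (bigID (fun i => i \in s) _ (fun i => (q i)^-1))/= addrA; congr (_ + _).
  rewrite [X in _ + X = _]big_mkcond -big_split/=; apply: eq_bigr => i _.
  by rewrite /expo /u; case: ifP => _; rewrite ?invrK ?addr0.
by apply: eq_bigl => i; rewrite finset.in_setC.
Qed.

Let expoV_gt0 s : (0 < m)%N -> 0 < \sum_(i < m) (expo s i)^-1.
Proof.
move=> m0; rewrite (bigD1 (Ordinal m0))//=; apply: ltr_wpDr.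
  by apply: sumr_ge0 => j _; rewrite invr_ge0 ltW// (lt_trans _ (expo_gt1 s j)).
by rewrite invr_gt0 (lt_trans _ (expo_gt1 s _)).
Qed.

Let loc x0 r (f : 'I_m -> Rn -> R) := split_fun x0 r finset.set0 f.

Let locE (x0 : Rn) r f i : loc x0 r f i = f i \_ (B x0 (2 * r)).
Proof. by rewrite /loc /split_fun finset.in_set0. Qed.

Let mem_Lfun (s : R) (h : Rn -> R) : measurable_fun setT h ->
  ('N[lebesgue_rV]_s%:E [EFin \o h] < +oo)%E -> h \in Lfun lebesgue_rV s%:E.
Proof. by move=> mh fh; rewrite inE/=; apply/andP; split; rewrite inE. Qed.

Let Lnorm_mul_loc (x0 : Rn) r f (d : Rn -> R) i :
  measurable_fun setT (f i) -> measurable_fun setT d ->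
  ('N[lebesgue_rV]_(u i)%:E [EFin \o (d \* loc x0 r f i)%R] <=
   Lnorm_on (q i) (B x0 (2 * r)) d * Lnorm_on (p i) (B x0 (2 * r)) (f i))%E.
Proof.
move=> mf md; have mB := measurable_euclidean_ball x0 (2 * r).
rewrite (_ : d \* loc x0 r f i = (d \_ (B x0 (2 * r))) \* (f i \_ (B x0 (2 * r)))).
  apply: generalized_hoelder => //.
  - exact: measurable_patch.
  - exact: measurable_patch.
  - by rewrite invr_gt0.
  - by rewrite invrK addrC.
by apply/funext => x /=; rewrite locE !patchE; case: ifP => // _; rewrite !mulr0.
Qed.

Let Lfun_mul_loc (x0 : Rn) r f d i : Lloc (p i) (f i) -> measurable_fun setT d ->
  (Lnorm_on (q i) (B x0 (2 * r)) d < +oo)%E ->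
  (d \* loc x0 r f i)%R \in Lfun lebesgue_rV (u i)%:E.
Proof.
move=> fl md Nd; have [mf _] := fl; have mB := measurable_euclidean_ball x0 (2 * r).
apply: mem_Lfun.
  by apply: measurable_funM => //; rewrite locE; exact: measurable_patch.
apply: le_lt_trans (Lnorm_mul_loc x0 r mf md) _.
have Nf : (Lnorm_on (p i) (B x0 (2 * r)) (f i) < +oo)%E.
  by apply: Lloc_ball => //; exact: ltW.
rewrite -(@fineK _ (Lnorm_on (q i) _ _)); last by rewrite ge0_fin_numE// Lnorm_on_ge0.
rewrite -(@fineK _ (Lnorm_on (p i) _ _)); last by rewrite ge0_fin_numE// Lnorm_on_ge0.
by rewrite -EFinM ltry.
Qed.

Let Lnorm_on_cst_lty (x0 : Rn) r i (a : R) : 0 < r ->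
  (Lnorm_on (q i) (B x0 (2 * r)) (fun=> a) < +oo)%E.
Proof.
move=> r0; have mB := measurable_euclidean_ball x0 (2 * r).
rewrite Lnorm_on_cst// volE ?poweR_EFin -?EFinM ?ltry//; lra.
Qed.

Let Lnorm_on_sub_lty (x0 : Rn) r b i (a : R) : Lloc (q i) b -> 0 < r ->
  (Lnorm_on (q i) (B x0 (2 * r)) (fun y => b y - a)%R < +oo)%E.
Proof.
move=> bl r0; have [mb _] := bl; have mB := measurable_euclidean_ball x0 (2 * r).
apply: le_lt_trans (Lnorm_onD (ltW (q_gt1 i)) mB mb _) _ => //.
rewrite lte_add_pinfty//; last exact: Lnorm_on_cst_lty.
by apply: Lloc_ball => //; exact: ltW.
Qed.

Let Lfun_loc (x0 : Rn) r f i : Lloc (p i) (f i) -> loc x0 r f i \in Lfun lebesgue_rV (p i)%:E.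
Proof.
move=> fl; have [mf _] := fl; rewrite locE; apply: mem_Lfun.
  by apply: measurable_patch => //; exact: measurable_euclidean_ball.
by apply: (@Lloc_ball R n (p i) (f i) x0 (2 * r)) => //; exact: ltW.
Qed.

Let Lfun_loc_u (x0 : Rn) r f i : Lloc (p i) (f i) -> 0 < r ->
  loc x0 r f i \in Lfun lebesgue_rV (u i)%:E.
Proof.
move=> fl r0; have := @Lfun_mul_loc x0 r f (fun=> 1) i fl (measurable_cst _)
  (Lnorm_on_cst_lty x0 i 1 r0).
rewrite (_ : _ \* _ = loc x0 r f i)//.
by apply/funext => y /=; rewrite mul1r.
Qed.

Let term_fun (x0 : Rn) r (d f : 'I_m -> Rn -> R) (s : {set 'I_m}) : 'I_m -> Rn -> R :=
  fun i => if i \in s then d i \* loc x0 r f i else loc x0 r f i.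

Let Lfun_term (x0 : Rn) r d f s i : Lloc (p i) (f i) -> measurable_fun setT (d i) ->
  (Lnorm_on (q i) (B x0 (2 * r)) (d i) < +oo)%E ->
  term_fun x0 r d f s i \in Lfun lebesgue_rV (expo s i)%:E.
Proof.
move=> fl md Nd; rewrite /term_fun /expo; case: ifP => _; last exact: Lfun_loc.
exact: Lfun_mul_loc.
Qed.

Hypothesis m_gt0 : (0 < m)%N.

(** [T] maps into L^e, with [e^-1] the sum of the inverses of [expo s], and Hoelder's inequality
    combines it with the [d i] outside [s], which are cut off to [B x0 r]. In the slots belonging to
    [s] the inequality is applied once more, inside the norms. *)
Let Lnorm_on_term (s : {set 'I_m}) : exists2 C : R, 0 < C &
  forall (x0 : Rn) r d f, 0 < r -> (forall i, Lloc (p i) (f i)) ->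
  (forall i, measurable_fun setT (d i)) ->
  (forall i, Lnorm_on (q i) (B x0 (2 * r)) (d i) < +oo)%E ->
  measurable_fun setT (T (term_fun x0 r d f s)) /\
  (Lnorm_on pp (B x0 r) (fun x => (-1) ^+ #|s| * (\prod_(i in ~: s) d i x) *
      T (term_fun x0 r d f s) x)%R <=
   C%:E * \prod_(i < m) (Lnorm_on (q i) (B x0 (2 * r)) (d i) *
     Lnorm_on (p i) (B x0 (2 * r)) (f i)))%E.
Proof.
have eE : (\sum_(i < m) (expo s i)^-1)^-1^-1 = \sum_(i < m) (expo s i)^-1 by rewrite invrK.
have [meas _ [C C0 HC]] := T_bounded (expo_gt1 s) eE.
exists C => // x0 r d f r0 fl md Nd.
have Lh i := @Lfun_term x0 r d f s i (fl i) (md i) (Nd i).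
have mT := meas _ Lh; split => //.
have mB := measurable_euclidean_ball x0 r; have mB2 := measurable_euclidean_ball x0 (2 * r).
have BB2 : B x0 r `<=` B x0 (2 * r).
  by move=> y; rewrite /euclidean_ball/= => /lt_le_trans; apply; lra.
set e := (\sum_(i < m) (expo s i)^-1)^-1.
have e0 : 0 < e by rewrite invr_gt0; exact: expoV_gt0.
have ppE' : pp^-1 = e^-1 + \sum_(i <- index_enum 'I_m | i \in (~: s)%SET) (q i)^-1.
  by rewrite invrK; exact: sum_expo.
have H := @generalized_hoelder_prod _ _ _ lebesgue_rV 'I_m (index_enum 'I_m)
  (fun i => i \in (~: s)%SET) q pp e _ (fun i => d i \_ (B x0 r)) mT
  (fun i => measurable_patch mB (md i)) pp_gt0 e0 q_gt0 ppE'.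
apply: (@le_trans _ _ ('N[lebesgue_rV]_pp%:E[EFin \o (fun x => T (term_fun x0 r d f s) x *
    \prod_(i in (~: s)%SET) (d i \_ (B x0 r)) x)%R])%E).
  apply: le_Lnorm_nomeas => [|x]; first exact: ltW.
  rewrite patchE; case: ifPn => [xB|_]; last by rewrite normr0.
  rewrite !normrM normrX normrN1 expr1n mul1r mulrC ler_wpM2l//.
  by under [in leRHS]eq_bigr do rewrite patchE xB.
apply: le_trans H _.
apply: le_trans (lee_wpmul2r _ (HC _ Lh)) _.
  by apply: prode_ge0 => i _; exact: Lnorm_ge0.
rewrite -muleA; apply: lee_wpmul2l; first by rewrite lee_fin ltW.
rewrite [X in (_ * X)%E]big_mkcond -big_split/=; apply: lee_prod => i _.
rewrite finset.in_setC /expo /term_fun; case: ifPn => /= si; apply/andP; split.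
- by rewrite mule1 Lnorm_ge0.
- rewrite mule1; apply: Lnorm_mul_loc => //; exact: (fl i).1.
- by rewrite mule_ge0// Lnorm_ge0.
- rewrite locE muleC; apply: lee_wpmul2r; first exact: Lnorm_ge0.
  by apply: le_Lnorm_on => //; exact: ltW.
Qed.

Local Notation tail_integral x0 r f :=
  (\int[lebesgue_measure]_(t in `](2 * r)%R, +oo[)
    (((1 + ln (t / r)) ^+ m *
      t `^ (n%:R * \sum_(i < m) lam i -
            n%:R * \sum_(i < m) (p i)^-1 - 1))%:E *
     \prod_(i < m) Lnorm_on (p i) (euclidean_ball x0 t) (f i)))%E.

(* Keep only the part [2r < t < 4r] of the integral. *)
Lemma Lnorm_on_le_tail_integral : exists2 C : R, 0 < C &
  forall (x0 : Rn) r f, 0 < r -> (forall i, Lloc (p i) (f i)) ->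
  (((2 * r) `^ (\sum_(i < m) (n%:R / q i + n%:R * lam i)))%:E *
    \prod_(i < m) Lnorm_on (p i) (B x0 (2 * r)) (f i) <=
   (C * r `^ (n%:R / pp))%:E * tail_integral x0 r f)%E.
Proof.
set e := _ - _ - 1.
(* The sign of [e] is not known, so for [2r < t < 4r] the bound used is
   [t ^ e >= 2 ^ (- |e|) * (2r) ^ e]. The power of [2 * r] to be reached has exponent
   [n / pp + e + 1], the 1 coming from the length of the interval; [2 ^ (n / pp)] turns
   [r ^ (n / pp)] into [(2r) ^ (n / pp)]. *)
exists (2 `^ (n%:R / pp) * 2 `^ `|e|); first by rewrite mulr_gt0 ?powR_gt0.
move=> x0 r f r0 fl; have D0 : 0 < 2 * r by lra.
set L := (\prod_(i < m) _)%E.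
have L0 : (0 <= L)%E by apply: prode_ge0 => i _; exact: Lnorm_on_ge0.
have LE : L = (fine L)%:E.
  rewrite fineK//; apply: prode_fin_num => i _; rewrite ge0_fin_numE ?Lnorm_on_ge0//.
  by apply: Lloc_ball => //; exact: ltW.
have l0 : 0 <= fine L by rewrite fine_ge0.
pose c := 2 `^ (- `|e|) * (2 * r) `^ e * fine L.
have ln0 t : 2 * r < t -> 0 <= ln (t / r).
  by move=> rt; rewrite ln_ge0// ler_pdivlMr// mul1r; lra.
have cI : ((c * (2 * r))%:E <= tail_integral x0 r f)%E.
  rewrite [leRHS]integral_mkcond; apply: le_integral_of_bump => //.
  - move=> t; rewrite patchE; case: ifPn => //; rewrite inE/= in_itv/= andbT => rt.
    rewrite mule_ge0//; last by apply: prode_ge0 => i _; exact: Lnorm_on_ge0.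
    by rewrite lee_fin mulr_ge0 ?powR_ge0// exprn_ge0// addr_ge0// ln0.
  - by rewrite !mulr_ge0 ?powR_ge0.
  move=> t /andP[rt tr]; rewrite patchE mem_set/=; last by rewrite in_itv/= rt.
  have t0 : 0 < t by lra.
  rewrite /c EFinM -LE; apply: lee_pmul => //.
  - by rewrite lee_fin mulr_ge0 ?powR_ge0.
  - rewrite lee_fin -/e -[leLHS]mul1r; apply: ler_pM => //.
    + by rewrite mulr_ge0 ?powR_ge0.
    + by rewrite exprn_ege1// lerDl ln0.
    have -> : t `^ e = (t / (2 * r)) `^ e * (2 * r) `^ e.
      by rewrite -powRM ?divfK ?divr_ge0 ?(ltW t0) ?(ltW D0)// gt_eqF.
    apply: ler_wpM2r; first exact: powR_ge0.
    set w := t / (2 * r).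
    have w1 : 1 <= w by rewrite ler_pdivlMr// mul1r ltW.
    have w2 : w <= 2 by rewrite ler_pdivrMr// ltW.
    apply: (@le_trans _ _ (w `^ (- `|e|))).
      rewrite !powRN lef_pV2 ?posrE ?powR_gt0//; last by lra.
      by apply: ge0_ler_powR; rewrite ?nnegrE//; lra.
    by apply: ler_powR => //; rewrite lerNl -normrN ler_norm.
  - apply: lee_prod => i _; rewrite Lnorm_on_ge0/=; apply: le_Lnorm_on.
      exact: ltW.
    by move=> y; rewrite /euclidean_ball/= => /lt_trans; exact.
apply: le_trans (lee_wpmul2l _ cI); last first.
  by rewrite lee_fin !mulr_ge0 ?powR_ge0.
rewrite LE -!EFinM lee_fin /c.
have -> : \sum_(i < m) (n%:R / q i + n%:R * lam i) = n%:R / pp + (e + 1).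
  rewrite big_split/= -!mulr_sumr ppE /e; ring.
rewrite powRD_gt0// powRD_gt0// powRr1 ?(ltW D0)// powRM ?(ltW r0)// powRN.
have : 2 `^ `|e| != 0 by rewrite gt_eqF// powR_gt0.
move: (2 `^ `|e|) => v v0; rewrite le_eqVlt; apply/orP; left; apply/eqP; field.
exact: v0.
Qed.

(** [g] is the same expansion with each [b i] replaced by its difference from the average. It is
    measurable since each of its terms is, and it agrees with the commutator only almost everywhere
    because [T] is linear only in that sense. *)
Lemma local_part_le : exists2 C : R, 0 < C & forall (x0 : Rn) r b f, 0 < r ->
  (forall i, campanato x0 (q i) (lam i) (b i)) -> (forall i, Lloc (p i) (f i)) ->
  exists g : Rn -> R, [/\ measurable_fun setT g,
    {ae lebesgue_rV, forall x,
      cz_commutator_cs T b (split_fun x0 r finset.set0 f) x = g x} &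
    (Lnorm_on pp (B x0 r) g <=
     (C * \prod_(i < m) fine (campanato_norm x0 (q i) (lam i) (b i)) *
      r `^ (n%:R / pp))%:E * tail_integral x0 r f)%E].
Proof.
have [C1 C10 HC1] := Lnorm_on_le_tail_integral.
have /choice[A HA] i : exists A : R, 0 < A /\ forall (x0 : Rn) b s t,
    campanato x0 (q i) (lam i) b -> 0 < s -> s <= t ->
    (Lnorm_on (q i) (B x0 t) (fun y => b y - average (B x0 s) b)%R <=
    (A * t `^ (n%:R / q i + n%:R * lam i) *
      fine (campanato_norm x0 (q i) (lam i) b))%:E)%E.
  by have [A A0 HA] := Lnorm_on_oscillation n_gt0 (q_gt1 i) (lam_gt0 i); exists A.
have /choice[C2 HC2] (s : {set 'I_m}) : exists C : R, 0 < C /\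
  forall (x0 : Rn) r d f, 0 < r -> (forall i, Lloc (p i) (f i)) ->
  (forall i, measurable_fun setT (d i)) ->
  (forall i, Lnorm_on (q i) (B x0 (2 * r)) (d i) < +oo)%E ->
  measurable_fun setT (T (term_fun x0 r d f s)) /\
  (Lnorm_on pp (B x0 r) (fun x => (-1) ^+ #|s| * (\prod_(i in ~: s) d i x) *
      T (term_fun x0 r d f s) x)%R <=
   C%:E * \prod_(i < m) (Lnorm_on (q i) (B x0 (2 * r)) (d i) *
     Lnorm_on (p i) (B x0 (2 * r)) (f i)))%E.
  by have [C C0 HC] := Lnorm_on_term s; exists C.
have SC20 : 0 < \sum_(s : {set 'I_m}) C2 s.
  rewrite (bigD1 finset.set0)//=; apply: ltr_wpDr; last exact: (HC2 _).1.
  by apply: sumr_ge0 => s _; exact: ltW (HC2 _).1.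
have PA0 : 0 < \prod_(i < m) A i by apply: prodr_gt0 => i _; exact: (HA i).1.
exists ((\sum_(s : {set 'I_m}) C2 s) * (\prod_(i < m) A i) * C1).
  by rewrite !mulr_gt0.
move=> x0 r b f r0 bC fl; pose d i y := b i y - average (B x0 r) (b i).
have mB := measurable_euclidean_ball x0 r.
have md i : measurable_fun setT (d i).
  by have [[mb _] _] := bC i; exact: measurable_funB.
have Nd i : (Lnorm_on (q i) (B x0 (2 * r)) (d i) < +oo)%E.
  by apply: Lnorm_on_sub_lty => //; exact: (bC i).1.
have Hs s := (HC2 s).2 x0 r d f r0 fl md Nd.
pose term (s : {set 'I_m}) (x : Rn) : R := (-1) ^+ #|s| * (\prod_(i in (~: s)%SET) d i x) *
  T (term_fun x0 r d f s) x.
have mterm s : measurable_fun setT (term s).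
  apply: measurable_funM; last exact: (Hs s).1.
  apply: measurable_funM => //.
  under eq_fun do rewrite -big_enum/=.
  by apply: measurable_prod => i _.
exists (fun x => \sum_(s : {set 'I_m}) term s x); split.
- exact: measurable_sum.
- have Lu j a : ((fun y => b j y - a) \* loc x0 r f j)%R \in Lfun lebesgue_rV (u j)%:E.
    apply: Lfun_mul_loc => //.
      by have [[mb _] _] := bC j; exact: measurable_funB.
    by apply: Lnorm_on_sub_lty => //; exact: (bC j).1.
  have uE : (\sum_(i < m) (u i)^-1)^-1^-1 = \sum_(i < m) (u i)^-1 by rewrite invrK.
  have [_ Tlin _] := T_bounded u_gt1 uE.
  exact: (cz_commutator_cs_shift Tlin (fun i => average (B x0 r) (b i))
    (fun j => Lfun_loc_u x0 (fl j) r0) Lu).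
have L0 : (0 <= \prod_(i < m) Lnorm_on (p i) (B x0 (2 * r)) (f i))%E.
  by apply: prode_ge0 => i _; exact: Lnorm_on_ge0.
have Pb0 : 0 <= \prod_(i < m) fine (campanato_norm x0 (q i) (lam i) (b i)).
  by apply: prodr_ge0 => i _; rewrite fine_ge0 ?campanato_norm_ge0.
have leP : (\prod_(i < m) (Lnorm_on (q i) (B x0 (2 * r)) (d i) *
     Lnorm_on (p i) (B x0 (2 * r)) (f i)) <=
    ((\prod_(i < m) A i) * \prod_(i < m) fine (campanato_norm x0 (q i) (lam i) (b i)))%:E *
    (((2 * r) `^ (\sum_(i < m) (n%:R / q i + n%:R * lam i)))%:E *
      \prod_(i < m) Lnorm_on (p i) (B x0 (2 * r)) (f i)))%E.
  have D0 : 0 < 2 * r by lra.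
  rewrite muleA -EFinM -powR_prod// -!big_split/= -prodEFin -big_split/=.
  apply: lee_prod => i _; rewrite mule_ge0 ?Lnorm_on_ge0//=.
  apply: lee_wpmul2r; first exact: Lnorm_on_ge0.
  rewrite mulrAC; apply: (HA i).2 => //; lra.
apply: (@le_trans _ _ (\sum_(s : {set 'I_m}) Lnorm_on pp (B x0 r) (term s))%E).
  apply: le_trans (Lnorm_sum lebesgue_rV (index_enum _) (ltW pp_gt1)
    (fun s => measurable_patch mB (mterm s))).
  apply: le_Lnorm_nomeas => [|x]; first exact: ltW.
  rewrite patchE; case: ifPn => xB; last by rewrite normr0.
  by under [in leRHS]eq_bigr do rewrite patchE xB.
apply: (@le_trans _ _ (\sum_(s : {set 'I_m}) ((C2 s)%:E *
    \prod_(i < m) (Lnorm_on (q i) (B x0 (2 * r)) (d i) *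
     Lnorm_on (p i) (B x0 (2 * r)) (f i))))%E).
  by apply: lee_sum => s _; exact: (Hs s).2.
rewrite -ge0_sume_distrl; last by move=> s _; rewrite lee_fin ltW// (HC2 s).1.
rewrite sumEFin; apply: le_trans (lee_wpmul2l _ leP) _; first by rewrite lee_fin ltW.
rewrite muleA -EFinM.
apply: le_trans (lee_wpmul2l _ (HC1 x0 r f r0 fl)) _.
  by rewrite lee_fin mulr_ge0 ?(ltW SC20)// mulr_ge0// ltW.
rewrite muleA -EFinM le_eqVlt; apply/orP; left; apply/eqP; congr (_%:E * _)%E; ring.
Qed.

End local_part.

(** * Conclusion *)

(** Hoelder's inequality with [excess] in L^(q i). The indicator of the ball takes the remaining
    inverse exponent, the sum of the [(p i)^-1], and this power of the volume completes the factors
    [r ^ (n / q i)] to [r ^ (n / pp)]. *)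
Lemma Lnorm_on_prod_excess (R : realType) (m n : nat) (n_gt0 : (0 < n)%N) (m_gt0 : (0 < m)%N)
    (pp : R) (p q lam : 'I_m -> R) (pp_gt1 : 1 < pp)
    (p_gt1 : forall i, 1 < p i) (q_gt1 : forall i, 1 < q i) (lam_gt0 : forall i, 0 < lam i)
    (ppE : pp^-1 = \sum_(i < m) (p i)^-1 + \sum_(i < m) (q i)^-1) :
  exists2 C : R, 0 < C & forall (x0 : 'rV[R]_n) r b, 0 < r ->
  (forall i, campanato x0 (q i) (lam i) (b i)) ->
  (Lnorm_on pp (euclidean_ball x0 r)
     (fun x => \prod_(i < m) excess (q i) (lam i) x0 r (b i) x)%R <=
   (C * \prod_(i < m) fine (campanato_norm x0 (q i) (lam i) (b i)) *
      r `^ (n%:R / pp))%:E)%E.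
Proof.
have /choice[A HA] i : exists A : R, 0 < A /\ forall (x0 : 'rV[R]_n) b r,
    campanato x0 (q i) (lam i) b -> 0 < r ->
    (Lnorm_on (q i) (euclidean_ball x0 r) (excess (q i) (lam i) x0 r b) <=
      (A * r `^ (n%:R / q i) * fine (campanato_norm x0 (q i) (lam i) b))%:E)%E.
  by have [A A0 HA] := Lnorm_on_excess n_gt0 (q_gt1 i) (lam_gt0 i); exists A.
have p_gt0 i : 0 < p i by apply: lt_trans (p_gt1 i).
have q_gt0 i : 0 < q i by apply: lt_trans (q_gt1 i).
have PA0 : 0 < \prod_(i < m) A i by apply: prodr_gt0 => i _; exact: (HA i).1.
set sp := \sum_(i < m) (p i)^-1.
have sp0 : 0 < sp.
  rewrite /sp (bigD1 (Ordinal m_gt0))//=; apply: ltr_wpDr; last by rewrite invr_gt0.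
  by apply: sumr_ge0 => j _; rewrite invr_ge0 ltW.
exists (2 `^ (n%:R * sp) * \prod_(i < m) A i); first by rewrite mulr_gt0 ?powR_gt0.
move=> x0 r b r0 bC; have mB := measurable_euclidean_ball x0 r.
have spV : 0 < sp^-1 by rewrite invr_gt0.
have me i : measurable_fun setT (excess (q i) (lam i) x0 r (b i)).
  by have [[mb _] _] := bC i; exact: measurable_excess.
have ppE' : pp^-1 = sp^-1^-1 + \sum_i (q i)^-1 by rewrite invrK.
apply: le_trans (hoelder_on mB me (lt_trans ltr01 pp_gt1) spV q_gt0 ppE') _.
rewrite invrK volE ?(ltW r0)// poweR_EFin.
have leP : (\prod_(i < m) Lnorm_on (q i) (euclidean_ball x0 r)
      (excess (q i) (lam i) x0 r (b i)) <=
    (\prod_(i < m) (A i * r `^ (n%:R / q i) *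
      fine (campanato_norm x0 (q i) (lam i) (b i))))%:E)%E.
  rewrite -prodEFin; apply: lee_prod => i _; rewrite Lnorm_on_ge0/=.
  exact: (HA i).2.
apply: le_trans (lee_wpmul2l _ leP) _; first by rewrite lee_fin powR_ge0.
rewrite -EFinM lee_fin 2!big_split/= powR_prod//.
have Pb0 : 0 <= \prod_(i < m) fine (campanato_norm x0 (q i) (lam i) (b i)).
  by apply: prodr_ge0 => i _; rewrite fine_ge0 ?campanato_norm_ge0.
rewrite (_ : n%:R / pp = n%:R * sp + \sum_(i < m) n%:R / q i); last first.
  by rewrite ppE mulrDr !mulr_sumr.
rewrite powRD_gt0// [leRHS](_ : _ = 2 `^ (n%:R * sp) * r `^ (n%:R * sp) *
  (\prod_(i < m) A i * r `^ (\sum_(i < m) n%:R / q i) *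
   \prod_(i < m) fine (campanato_norm x0 (q i) (lam i) (b i)))); last by ring.
apply: ler_wpM2r; last by apply: vol_powR_le => //; exact: ltW.
by apply: mulr_ge0 => //; apply: mulr_ge0; [exact: ltW|exact: powR_ge0].
Qed.

Theorem theorem4p1 (R : realType) (m n : nat) (m_gt0 : (0 < m)%N)
    (n_gt0 : (0 < n)%N) (K : m.+1.-tuple 'rV[R]_n -> R)
    (S : ('I_m -> 'rV[R]_n -> R) -> ('rV[R]_n -> R) -> R)
    (T : ('I_m -> 'rV[R]_n -> R) -> 'rV[R]_n -> R)
    (kerK : cz_kernel K) (czS : cz_operator K S) (extT : bounded_extension S T)
    (x0 : 'rV[R]_n) (p : R) (p_ q_ lambda_ : 'I_m -> R)
    (p_gt1 : 1 < p) (p_i_gt1 : forall i, 1 < p_ i) (q_i_gt1 : forall i, 1 < q_ i)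
    (pE : p^-1 = \sum_(i < m) (p_ i)^-1 + \sum_(i < m) (q_ i)^-1)
    (lambda_bnd : forall i, 0 < lambda_ i < n%:R^-1) :
  exists2 C : R, 0 < C &
  forall b : 'I_m -> 'rV[R]_n -> R,
    (forall i, campanato x0 (q_ i) (lambda_ i) (b i)) ->
  forall r : R, 0 < r ->
  forall f : 'I_m -> 'rV[R]_n -> R, (forall i, Lloc (p_ i) (f i)) ->
  let I := (\int[lebesgue_measure]_(t in `](2 * r)%R, +oo[)
    (((1 + ln (t / r)) ^+ m *
      t `^ (n%:R * \sum_(i < m) lambda_ i -
            n%:R * \sum_(i < m) (p_ i)^-1 - 1))%:E *
     \prod_(i < m) Lnorm_on (p_ i) (euclidean_ball x0 t) (f i)))%E in
  (I < +oo)%E ->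
  {ae lebesgue_rV, forall x, euclidean_ball x0 r x ->
    forall alpha : {set 'I_m}, alpha != finset.set0 ->
    (tuple_measure lebesgue_rV m).-integrable setT
      (EFin \o cz_commutator_integrand K b (split_fun x0 r alpha f) x)} /\
  (Lnorm_on p (euclidean_ball x0 r) (cz_commutator K T x0 r b f) <=
    C%:E * (\prod_(i < m) campanato_norm x0 (q_ i) (lambda_ i) (b i)) *
    (r `^ (n%:R / p))%:E * I)%E.
Proof.
have lam_gt0 i : 0 < lambda_ i by case/andP: (lambda_bnd i).
have pq_lt1 := sum_exponents_lt1 p_gt1 p_i_gt1 q_i_gt1 pE.
have [C1 C10 HC1] := local_part_le n_gt0 p_gt1 p_i_gt1 q_i_gt1 lam_gt0 pE extT.2 m_gt0.
have [C2 C20 HC2] := tail_integral_le n_gt0 kerK p_i_gt1 q_i_gt1 lam_gt0 pq_lt1.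
have [C3 C30 HC3] := Lnorm_on_prod_excess n_gt0 m_gt0 p_gt1 p_i_gt1 q_i_gt1 lam_gt0 pE.
have p_gt0 : 0 < p by apply: lt_trans p_gt1.
pose N : R := #|{set 'I_m}|%:R.
have N0 : 0 <= N by [].
(* [C1] is the cost of the local part, [C2] that of one mixed integral, [C3] that of the norm of the
   product of the [excess] functions; [N] bounds the number of mixed integrals. *)
exists (C1 + N * C2 * C3) => [|b bC r r0 f fl I Ioo].
  by rewrite ltr_wpDr// mulr_ge0 ?mulr_ge0// ltW.
have mf i : measurable_fun setT (f i) by exact: (fl i).1.
have mb i : measurable_fun setT (b i) by have [[]] := bC i.
have mB := measurable_euclidean_ball x0 r.
have I0 : (0 <= I)%E.
  apply: integral_ge0 => t; rewrite /= in_itv/= andbT => rt.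
  rewrite mule_ge0//; last by apply: prode_ge0 => i _; exact: Lnorm_on_ge0.
  rewrite lee_fin mulr_ge0 ?powR_ge0// exprn_ge0// addr_ge0// ln_ge0//.
  by rewrite ler_pdivlMr// mul1r; lra.
have IE : I = (fine I)%:E by rewrite fineK// ge0_fin_numE.
pose E x := \prod_(i < m) excess (q_ i) (lambda_ i) x0 r (b i) x.
have E0 x : 0 <= E x by apply: prodr_ge0 => i _; exact: excess_ge0.
have tailE x alpha : euclidean_ball x0 r x -> alpha != finset.set0 ->
    (\int[tuple_measure lebesgue_rV m]_y
      `|cz_commutator_integrand K b (split_fun x0 r alpha f) x y|%:E <=
     (C2 * E x * fine I)%:E)%E.
  by move=> xr a0; rewrite EFinM -IE; exact: HC2.
have tail_int x alpha : euclidean_ball x0 r x -> alpha != finset.set0 ->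
    (tuple_measure lebesgue_rV m).-integrable setT
      (EFin \o cz_commutator_integrand K b (split_fun x0 r alpha f) x).
  move=> xr a0; apply/integrableP; split.
    apply/measurable_EFinP; apply: measurable_cz_commutator_integrand => // i.
    exact: measurable_split_fun.
  by apply: le_lt_trans (tailE x alpha xr a0) _; rewrite ltry.
split; first by apply: aeW => x xr alpha; exact: tail_int.
have [g [mg gE Ng]] := HC1 x0 r b f r0 bC fl.
pose c := N * C2 * fine I.
have c0 : 0 <= c by rewrite !mulr_ge0 ?fine_ge0// ltW.
have mE : measurable_fun setT E.
  by apply: measurable_prod => i _; exact: measurable_excess.
have mcE : measurable_fun setT (fun x => c * E x) by apply: measurable_funM.
have mng : measurable_fun setT (fun x => `|g x|) by apply: measurableT_comp.
(* The majorant on the right is measurable and dominates the commutator at almost every point of the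
   ball. *)
apply: (@le_trans _ _ (Lnorm_on p (euclidean_ball x0 r)
    ((fun x => `|g x|) \+ (fun x => c * E x))%R)).
  apply: ae_le_Lnorm_nomeas; first exact: ltW.
    by apply: measurable_patch => //; exact: measurable_funD.
  apply: filterS gE => x gx; rewrite !patchE; case: ifPn => // /set_mem xr.
  rewrite [leRHS]ger0_norm/=; last by rewrite addr_ge0// mulr_ge0.
  rewrite /cz_commutator gx; apply: le_trans (ler_normD _ _) _; rewrite lerD2l.
  apply: le_trans (ler_norm_sum _ _ _) _.
  (* The empty [alpha] is given the same nonnegative bound, so that the sum has exactly [N] equal
     terms. *)
  rewrite big_mkcond/=; apply: (@le_trans _ _ (\sum_(alpha : {set 'I_m}) C2 * E x * fine I)).
    apply: ler_sum => alpha _; case: ifPn => a0; last first.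
      by rewrite !mulr_ge0 ?fine_ge0// ltW.
    apply: le_trans (le_normr_Rintegral measurableT (tail_int x alpha xr a0)) _.
    rewrite /Rintegral -lee_fin fineK; first exact: tailE.
    by apply: integrable_fin_num => //; exact: (integrable_abse (tail_int x alpha xr a0)).
  rewrite sumr_const -mulr_natr le_eqVlt; apply/orP; left; apply/eqP.
  by rewrite /c /N; ring.
apply: le_trans (Lnorm_onD (ltW p_gt1) mB mng mcE) _.
have -> : Lnorm_on p (euclidean_ball x0 r) (fun x => `|g x|) =
    Lnorm_on p (euclidean_ball x0 r) g.
  rewrite /Lnorm_on -[RHS]Lnorm_abse; congr Lnorm; apply/funext => x /=; congr EFin.
  by rewrite norm_patch.
have -> : Lnorm_on p (euclidean_ball x0 r) (fun x => c * E x) =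
    (c%:E * Lnorm_on p (euclidean_ball x0 r) E)%E.
  rewrite /Lnorm_on -LnormZ_EFin//; last exact: measurable_patch.
  congr Lnorm; apply/funext => x /=; congr EFin; rewrite !patchE.
  by case: ifPn => // _; rewrite mulr0.
apply: le_trans (leeD Ng (lee_wpmul2l _ (HC3 x0 r b r0 bC))) _; first by rewrite lee_fin.
have -> : (\prod_(i < m) campanato_norm x0 (q_ i) (lambda_ i) (b i))%E =
    (\prod_(i < m) fine (campanato_norm x0 (q_ i) (lambda_ i) (b i)))%:E.
  by rewrite -prodEFin; apply: eq_bigr => i _; exact: campanato_normE.
rewrite -/I IE -!EFinM -EFinD lee_fin /c le_eqVlt; apply/orP; left; apply/eqP; ring.
Qed.
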